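(* The Lusternik–Schnirelmann category $\mathsf{cat}(X)$ of a random simplicial complex $X\subset\Delta_n$ in the medial regime satisfies $\mathsf{cat}(X)\le 1$ asymptotically almost surely (i.e. with probability tending to $1$ as $n\to\infty$).
   Context: Simplexes are non-empty. $\Delta_n$ is the simplex with vertex set $[n]=\{1,\dots,n\}$, whose simplexes are all non-empty subsets of $[n]$. Lower multi-parameter model: given numbers $p_\sigma\in[0,1]$ for each simplex $\sigma$ of $\Delta_n$ (they may depend on $n$), $\mathcal P$ is the unique probability measure on the set of all simplicial subcomplexes $X\subset\Delta_n$ (the vertex set of $X$ may be a proper subset of $[n]$) such that for every subcomplex $L\subset\Delta_n$ one has $\mathcal P\{X: L\subset X\}=\prod_{\sigma\in L}p_\sigma$. Medial regime: there are constants $0<p\le P<1$ independent of $n$ such that $p\le p_\sigma\le P$ for all $n$ and all simplexes $\sigma$ of $\Delta_n$. The (reduced) Lusternik–Schnirelmann category $\mathsf{cat}(X)$ of a space $X$ is the smallest integer $k\ge 0$ such that $X$ admits an open cover $X=U_0\cup U_1\cup\dots\cup U_k$ with each inclusion $U_i\to X$ null-homotopic. For a simplicial complex it is taken of the geometric realisation. *)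

(* Defs.v *)
From HB Require Import structures.
From mathcomp Require Import all_boot all_order all_algebra.
From mathcomp Require Import all_classical all_reals all_analysis.
Set Implicit Arguments.
Unset Strict Implicit.
Unset Printing Implicit Defensive.
Import Order.TTheory GRing.Theory Num.Theory.
Import numFieldNormedType.Exports.
Local Open Scope classical_set_scope.
Local Open Scope ring_scope.

Definition homotopic (R : realType) (T U : topologicalType) (f g : T -> U) :=
  exists H : T * R -> U,
    [/\ {within [set: T] `*` `[0, 1], continuous H},
        forall x, H (x, 0) = f x & forall x, H (x, 1) = g x].

Definition null_homotopic (R : realType) (T U : topologicalType)
    (f : T -> U) :=
  exists y : U, homotopic R f (cst y).

Definition categorical_cover (R : realType) (T : topologicalType) (k : nat) :=
  exists U : 'I_k.+1 -> set T,
    [/\ forall i, open (U i),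
        \bigcup_i U i = [set: T] &
        forall i, null_homotopic R (set_val : U i -> T)].

(* The infimum of a set of naturals in \bar R is its least element, or +oo
   when the set is empty. The empty space has LScat = +oo, as no point is
   available for the constant map. *)
Definition LScat (R : realType) (T : topologicalType) : \bar R :=
  ereal_inf [set k%:R%:E | k in [set k | categorical_cover R T k]].

(* The vertex set {1, ..., n} is 'I_n; simplexes are the nonempty subsets. *)
Definition is_subcomplex (n : nat) (X : {set {set 'I_n}}) : bool :=
  [forall s in X, (s != finset.set0) &&
    [forall t : {set 'I_n}, (t \subset s) && (t != finset.set0) ==> (t \in X)]].

Record subcomplex (n : nat) := Subcomplex {
  simplices :> {set {set 'I_n}};
  subcomplexP : is_subcomplex simplices }.

HB.instance Definition _ n := [isSub for @simplices n].
HB.instance Definition _ n := [Finite of subcomplex n by <:].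

Lemma is_subcomplex0 n : is_subcomplex (finset.set0 : {set {set 'I_n}}).
Proof. by apply/forall_inP => s; rewrite finset.inE. Qed.

HB.instance Definition _ n :=
  isPointed.Build (subcomplex n) (Subcomplex (is_subcomplex0 n)).
HB.instance Definition _ n :=
  @isMeasurable.Build default_measure_display (subcomplex n)
    discrete_measurable discrete_measurable0
    discrete_measurableC discrete_measurableU.

(* Barycentric coordinates: points of the standard simplex in R^n whose
   support is a simplex of X, with the topology induced from R^n. *)
Definition realization (R : realType) (n : nat) (X : subcomplex n) :
    topologicalType :=
  set_type [set x : 'rV[R]_n |
    [/\ forall i, 0 <= x ord0 i, \sum_i x ord0 i = 1 &
        [set i | x ord0 i != 0]%SET \in simplices X]].

(* This identity for all L determines mu. The value of p at the empty set is
   never used. *)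
Definition lower_model (R : realType) (n : nat) (p : {set 'I_n} -> R)
    (mu : probability (subcomplex n) R) :=
  forall L : subcomplex n,
    mu [set X | simplices L \subset simplices X] = (\prod_(s in simplices L) p s)%:E.

Definition medial_regime (R : realType) (p : forall n, {set 'I_n} -> R) :=
  exists a b : R, [/\ 0 < a, a <= b, b < 1 &
    forall n (s : {set 'I_n}), s != finset.set0 -> a <= p n s <= b].

(* Main.v *)
(* A complex is [k]-conic if each of its subcomplexes with at most [k] faces
   lies in the base of a cone contained in the complex.  With overwhelming
   probability the random complex is [3 ^ q]-conic and has only simplexes with
   at most [2 q] vertices, where [q] is chosen with [3 ^ q << ln n << 4 ^ q]: a
   cone over [k] faces exists because its expected number is at least
   [n a ^ k] and different apexes are independent, while a simplex with
   [2 q + 1] vertices involves [2 ^ (2 q + 1) - 1] faces.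

   If [X] is [3 ^ q]-conic, its skeleton of simplexes with at most [q] vertices
   contracts in [X].  To see this fix a vertex [v] and push the skeleton into
   the faces joinable to [v], removing minimal non-joinable faces [s] one after
   another: the open star of [s] is pushed away along a contraction of the link
   of [s], and that link is still [3 ^ (q - #|s|)]-conic, because the sphere
   bounding [v |: s] has at most [3 ^ #|s|] faces, the empty one included.

   Finally let [h] be the [(q + 1)]-st largest barycentric coordinate.  The open
   set where some coordinate exceeds [h] is deformed into the skeleton by
   [x |-> (x - h)^+], and the open set [h > 0] by a map whose support consists
   of the successive record coordinates of [min(x, h)]; hence both are
   contractible in [X]. *)
Require Import Defs.
From HB Require Import structures.
From mathcomp Require Import all_boot all_order all_algebra.
From mathcomp Require Import zify ring lra.
Set Implicit Arguments.
Unset Strict Implicit.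
Unset Printing Implicit Defensive.

(** * Conic families of faces *)

Section Conic.
Variable T : finType.
Implicit Types (F Y A : {set {set T}}) (s t r : {set T}) (v w : T).

Definition down_closed F := forall s t, t \subset s -> s \in F -> t \in F.

Definition skeleton q F := [set s in F | #|s| <= q].

(** [A] contains the empty face, so [k] counts that face too; as [w] avoids every member of [A], the
    cone is a genuine one. *)
Definition conic k F := forall A,
  down_closed A -> set0 \in A -> A \subset F -> #|A| <= k ->
  exists w, forall t, t \in A -> w \notin t /\ w |: t \in F.

Definition minimal_obstruction F v s :=
  v |: s \notin F /\ forall r, r \proper s -> v |: r \in F.

(* The faces over which the link of [s] may be contracted while [s] is being
   removed from the subcomplex [Y]. *)
Definition residual F Y s := [set t : {set T} | [&& t :&: s == set0, t :|: s \in F &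
  [forall (r : {set T} | r \proper s), t :|: r \in Y]]].

Lemma down_closed_skeleton q F : down_closed F -> down_closed (skeleton q F).
Proof.
move=> dF s t ts; rewrite !inE => /andP[sF sq].
by rewrite (dF _ _ ts sF) (leq_trans (subset_leq_card ts)).
Qed.

Lemma residualP F Y s t : reflect
  [/\ t :&: s = set0, t :|: s \in F & forall r, r \proper s -> t :|: r \in Y]
  (t \in residual F Y s).
Proof.
by rewrite inE; apply: (iffP and3P) => -[ts tF tY]; split => //;
  [exact/eqP | exact/forall_inP | exact/eqP | exact/forall_inP].
Qed.

Lemma down_closed_residual F Y s :
  down_closed F -> down_closed Y -> down_closed (residual F Y s).
Proof.
move=> dF dY t t' t't /residualP[ts tF tY]; apply/residualP; split.
- by apply/eqP; rewrite -subset0 -ts setSI.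
- by apply: dF tF; exact: setSU.
- by move=> r rs; apply: dY (tY r rs); exact: setSU.
Qed.

(** Source of the base [3]: a proper face of the simplex on [v] and [s] is one of the [2 ^ #|s|]
    subsets of [s], or [v] joined to one of the [2 ^ #|s| - 1] proper ones. Their number is at most
    [3 ^ #|s|], with equality when [s] is a single vertex. *)
Lemma exp3_ge s : s != set0 -> 2 ^ #|s| + 2 ^ #|s| <= (3 ^ #|s|).+1.
Proof.
rewrite -card_gt0; elim: #|s| => // -[//|n] IHn _.
have := IHn isT; have : 0 < 3 ^ n.+1 by rewrite expn_gt0.
by rewrite !(expnS _ n.+1); lia.
Qed.

Lemma card_proper_subsets s : #|[set r : {set T} | r \proper s]| = (2 ^ #|s|).-1.
Proof.
rewrite -card_powerset (cardsD1 s (powerset s)) powersetE subxx add1n /=.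
by apply: eq_card => r; rewrite !inE properEneq.
Qed.

Lemma card_imset2_le (f : {set T} -> {set T} -> {set T}) A Y :
  #|[set f t r | t in A, r in Y]| <= #|A| * #|Y|.
Proof. by rewrite curry_imset2X -cardsX leq_imset_card. Qed.

(** The apex [w] is taken over the join of [A] with the boundary of [v |: s]. Were [w |: (t :|: r)]
    outside [Y], it would contain a minimal obstruction outside [Y], necessarily through [w].
    Without [w] this obstruction is joinable to [v], so its join with [v] belongs to the coned
    family, and adding [w] makes the obstruction itself joinable, a contradiction. *)
Lemma conic_residual F Y v s k : down_closed F -> down_closed Y -> Y \subset F ->
  s \in F -> s != set0 -> minimal_obstruction F v s ->
  (forall t, t \in F -> t \notin Y ->
    exists s', [/\ s' \subset t, s' \notin Y & minimal_obstruction F v s']) ->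
  conic (3 ^ #|s| * k) F -> conic k (residual F Y s).
Proof.
move=> dF dY YF sF s0 [sv smin] FY cF A dA A0 AL Ak.
have AP t : t \in A -> t \in residual F Y s by move/(subsetP AL).
(* The join of [A] with the boundary sphere of [v |: s], as far as it lies in
   [F]: this is what the new vertex has to cone off. *)
pose B1 := [set t :|: r | t in A, r in powerset s].
pose B2 := [set v |: (t :|: r) | t in A, r in [set r : {set T} | r \proper s]].
pose B := B1 :|: (B2 :&: F).
have B1P t r : t \in A -> r \subset s -> t :|: r \in B1.
  by move=> tA rs; apply/imset2P; exists t r; rewrite ?powersetE.
have [||||w wP] := cF B.
- have dB1 : down_closed B1.
    move=> b x xb /imset2P[t r tA]; rewrite powersetE => rs bE; rewrite bE in xb.
    have -> : x = (x :&: t) :|: (x :&: r).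
      by rewrite -setIUr; apply/esym/setIidPl.
    apply: B1P; first by apply: dA tA; exact: subsetIr.
    exact: subset_trans (subsetIr _ _) rs.
  move=> b x xb; rewrite !in_setU => /orP[bB|].
    by rewrite (dB1 _ _ xb bB).
  case/setIP=> bB bF; have xF := dF _ _ xb bF.
  case/imset2P: bB => t r tA; rewrite inE => rs bE.
  have [vx|vx] := boolP (v \in x); last first.
    rewrite (dB1 _ x _ (B1P _ _ tA (proper_sub rs))) //.
    apply/subsetP => y yx; have := subsetP xb _ yx; rewrite bE !inE.
    by case/predU1P => // yv; rewrite -yv yx in vx.
  rewrite [X in _ || X]inE xF andbT; apply/orP; right.
  have -> : x = v |: ((x :&: t) :|: (x :&: r)).
    apply/setP=> y; rewrite !inE; have [->//|yv] := eqVneq y v.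
    have [yx|//] := boolP (y \in x).
    by have := subsetP xb _ yx; rewrite bE !inE (negPf yv).
  apply: imset2_f; last by rewrite inE (sub_proper_trans _ rs) ?subsetIr.
  by apply: dA tA; exact: subsetIr.
- by rewrite in_setU -(setU0 set0) B1P ?sub0set.
- apply/subsetP => b; rewrite in_setU => /orP[|/setIP[]//].
  case/imset2P=> t r /AP/residualP[_ tF _]; rewrite powersetE => rs ->.
  by apply: dF tF; exact: setUS.
- rewrite (leq_trans (leq_card_setU _ _)) //.
  have le1 : #|B1| <= #|A| * 2 ^ #|s|.
    by rewrite -card_powerset; exact: card_imset2_le.
  have le2 : #|B2 :&: F| <= #|A| * (2 ^ #|s|).-1.
    apply: leq_trans (subset_leq_card (subsetIl _ _)) _.
    rewrite -card_proper_subsets.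
    exact: (card_imset2_le (fun t r => v |: (t :|: r))).
  apply: leq_trans (leq_add le1 le2) _; rewrite -mulnDr mulnC leq_mul //.
  rewrite -ltnS -addnS prednK ?expn_gt0 //; exact: exp3_ge.
exists w => t tA; have /residualP[ts tsF tY] := AP _ tA.
have wP1 t' r : t' \in A -> r \subset s -> w \notin t' :|: r /\ w |: (t' :|: r) \in F.
  by move=> t'A rs; apply: wP; rewrite in_setU B1P.
split; first by have [] := wP1 _ _ tA (sub0set _); rewrite setU0.
have [ws wtsF] := wP1 _ _ tA (subxx s).
apply/residualP; split; last 1 first.
- move=> r rs; have rs' := proper_sub rs.
  have [wr wF] := wP1 _ _ tA rs'; rewrite -setUA.
  apply/negPn/negP => /(FY _ wF)[s' [s'sub s'Y [vs'F s'min]]].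
  have [ws'|ws'] := boolP (w \in s'); last first.
    case/negP: s'Y; apply: dY (tY r rs); apply/subsetP=> x xs'.
    have := subsetP s'sub _ xs'; rewrite !inE => /predU1P[xw|//].
    by rewrite -xw xs' in ws'.
  have sub' : s' :\ w \subset t :|: r by rewrite subDset.
  have pr : s' :\ w \proper s' by rewrite properD1.
  have vF := s'min _ pr.
  have E : s' :\ w = ((s' :\ w) :&: t) :|: ((s' :\ w) :&: r).
    by rewrite -setIUr; apply/esym/setIidPl.
  have [|_] := wP (v |: (s' :\ w)).
    rewrite in_setU [X in _ || X]inE vF andbT; apply/orP; right.
    rewrite {1}E; apply: imset2_f; first by apply: dA tA; exact: subsetIr.
    by rewrite inE (sub_proper_trans _ rs) ?subsetIr.
  by rewrite setUCA setD1K ?(negPf vs'F).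
- rewrite setIUl ts setU0; apply/eqP; rewrite setI_eq0 disjoints1.
  by move: ws; rewrite inE negb_or => /andP[].
- by rewrite -setUA.
Qed.

End Conic.

(** * Counting the families that have to be coned off *)

Section Counting.
Variable T : finType.
Implicit Types (A L : {set {set T}}) (s t : {set T}) (v w : T).

Lemma card_draws_le m : #|[set s : {set T} | #|s| == m]| <= #|T| ^ m.
Proof.
rewrite -card_tuple -cardsT.
apply: leq_trans (leq_imset_card (fun t : m.-tuple T => [set x in t]) _).
apply/subset_leq_card/subsetP => s; rewrite inE => sm.
have em : size (enum s) == m by rewrite -cardE.
by apply/imsetP; exists (Tuple em) => //; apply/setP => x; rewrite inE mem_enum.
Qed.

Definition vcone v A := A :|: [set v |: t | t in A].

Lemma down_closed_vcone v A : down_closed A -> down_closed (vcone v A).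
Proof.
move=> dA s t ts; rewrite !inE => /orP[sA|/imsetP[r rA sE]].
  by rewrite (dA _ _ ts sA).
have [vt|vt] := boolP (v \in t).
  apply/orP; right; apply/imsetP; exists (t :\ v); last by rewrite setD1K.
  by apply: dA rA; rewrite subDset -sE.
rewrite (dA r) //; apply/subsetP => x xt.
have := subsetP ts _ xt; rewrite sE !inE => /predU1P[xv|//].
by rewrite -xv xt in vt.
Qed.

(** Each vertex of a down-closed family is a singleton member of it. *)
Lemma card_cover_le A : down_closed A -> #|cover A| <= #|A|.
Proof.
move=> dA; rewrite -(card_imset _ set1_inj).
apply/subset_leq_card/subsetP => _ /imsetP[v /bigcupP[t tA vt] ->].
by apply: dA tA; rewrite sub1set.
Qed.

Definition small_families k := [set A : {set {set T}} |
  [&& set0 \in A, #|A| <= k & #|cover A| <= k]].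

(* A family in [small_families k] is recovered from an enumeration of its
   vertices and the list of its members, read as sets of indices. *)
Lemma card_small_families k : 0 < #|T| ->
  #|small_families k| <= #|T| ^ k * 2 ^ (k * k).
Proof.
case/card_gt0P=> x0 _.
pose decode (u : (k.-tuple T) * (k.-tuple {set 'I_k})) : {set {set T}} :=
  [set [set tnth u.1 j | j in b] | b : {set 'I_k} in u.2].
have -> : #|T| ^ k * 2 ^ (k * k) = #|[set: (k.-tuple T) * (k.-tuple {set 'I_k})]|.
  rewrite cardsT card_prod !card_tuple expnM; congr (_ * _ ^ _).
  by rewrite -cardsT -[in RHS]powersetT card_powerset cardsT card_ord.
apply: leq_trans (leq_imset_card decode _).
apply/subset_leq_card/subsetP => A; rewrite inE => /and3P[A0 Ak Ck].
pose f := [tuple nth x0 (enum (cover A)) i | i < k].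
pose b (s : {set T}) := [set j : 'I_k | tnth f j \in s].
pose B := [tuple b (nth set0 (enum A) i) | i < k].
have fb s : s \in A -> [set tnth f j | j in b s] = s.
  move=> sA; apply/setP => x; apply/imsetP/idP => [[j]|xs].
    by rewrite inE => + ->.
  have xC : x \in enum (cover A) by rewrite mem_enum; apply/bigcupP; exists s.
  have xk : index x (enum (cover A)) < k.
    by apply: leq_trans Ck; rewrite cardE index_mem.
  have fx : tnth f (Ordinal xk) = x by rewrite tnth_mktuple nth_index.
  by exists (Ordinal xk) => //; rewrite inE fx.
(* Positions beyond the end of the list are padded with [set0], which [A] contains, so the padding
   adds no foreign member. *)
have nA i : nth set0 (enum A) i \in A.
  have [iA|iA] := ltnP i (size (enum A)); last by rewrite nth_default.
  by rewrite -mem_enum mem_nth.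
apply/imsetP; exists (f, B) => //; apply/setP => s; apply/idP/imsetP => [sA|].
  exists (b s); last by rewrite fb.
  have sk : index s (enum A) < k.
    by apply: leq_trans Ak; rewrite cardE index_mem mem_enum.
  by apply/tnthP; exists (Ordinal sk); rewrite tnth_mktuple nth_index // mem_enum.
by case=> c /tnthP[i ->] ->; rewrite tnth_mktuple fb.
Qed.

(** Puts conicity into the form used by the union bound: the families to be coned off come from a
    collection of controlled size. *)
Lemma conicI k A :
  (forall L, L \in small_families k -> down_closed L -> L \subset A ->
    exists2 w, w \notin cover L & vcone w L \subset A) -> conic k A.
Proof.
move=> H L dL L0 LA Lk; have [|w wL wA] := H L _ dL LA.
  by rewrite inE L0 Lk (leq_trans (card_cover_le dL)).
exists w => t tL; split.
  by apply: contra wL => wt; apply/bigcupP; exists t.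
by apply: (subsetP wA); rewrite inE; apply/orP; right; exact: imset_f.
Qed.

End Counting.

(** * Choice of the exponent *)

(** The constants are those that close the two inductions: [3 * 3 + 3 = 4 * 3] for the linear
    factor, then [3 * 18 + 6 * 3 = 4 * 18] for the quadratic one. *)
Lemma exp3_exp4 q : q * q.-1 * 3 ^ q <= 18 * 4 ^ q.
Proof.
have H m : m * 3 ^ m <= 3 * 4 ^ m.
  elim: m => // m IHm; have : 3 ^ m <= 4 ^ m by case: (m) => // k; rewrite leq_exp2r.
  by rewrite !expnS; nia.
elim: q => // q IHq; rewrite /= !expnS; have := H q; case: q IHq => // q /=.
by nia.
Qed.

Lemma linear_exp3_le_exp4 C q : 18 * C + 3 <= q -> C * q.+1 * 3 ^ q <= 4 ^ q.
Proof.
move=> Cq; have := exp3_exp4 q; set x := 3 ^ q; set y := 4 ^ q => xy.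
have h : 18 * (C * q.+1) <= q * q.-1 by nia.
have : 18 * (C * q.+1) * x <= q * q.-1 * x by rewrite leq_mul2r h orbT.
nia.
Qed.

(** Used with [m = K./2], where [2 * m + 1] bounds [K]; at [m = 10] it reads [945 <= 1024]. *)
Lemma quadratic_le_exp2 m : 10 <= m -> 2 * (2 * m).+1 ^ 2 + 3 * (2 * m).+1 <= 2 ^ m.
Proof.
elim: m => // m IHm; rewrite leq_eqVlt => /orP[/eqP <-|]; first by [].
move=> m10; have := IHm m10; rewrite (expnS 2 m) -!mulnn; set y := 2 ^ m => h.
have mm : 10 * m <= m * m by rewrite leq_mul2r; apply/orP; right.
have E1 : 2 * ((2 * m.+1).+1 * (2 * m.+1).+1) = 8 * (m * m) + 24 * m + 18 by ring.
have E2 : 2 * ((2 * m).+1 * (2 * m).+1) = 8 * (m * m) + 8 * m + 2 by ring.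
by rewrite E1; rewrite E2 in h; lia.
Qed.

(** [K] stands for the binary logarithm of [n], and [c] for an exponent with [2^-1 ^+ c <= a] and
    [b ^+ c <= 2^-1]. With [3 ^ q] of order [K / (4 c)], the exponent [2 * 4 ^ q] outgrows [K * q],
    which rules out large simplexes, while [a ^+ (3 ^ q)] stays above [2 ^ (- K / 4)], which leaves
    enough apexes. *)
Lemma exponent_choice c : 0 < c -> exists K0, forall K, K0 <= K -> exists q,
  [/\ c * ((K.+1) * (q + q).+1 + K) <= (2 ^ (q + q).+1).-1, 3 ^ q <= K &
      2 ^ (c * 3 ^ q) * (2 * K ^ 2 + 2 * K) + K <= 2 ^ K].
Proof.
(* The threshold forces [18 * C + 3 <= q] and [10 <= K./2]. The value of [C] comes from
   [K < 12 * c * 3 ^ q], multiplied by [c] and by [2 * q.+1]. *)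
move=> c0; pose C := 24 * c ^ 2; exists (4 * c * 3 ^ (18 * C + 3) + 20) => K KK.
have c4 : 0 < 4 * c by rewrite muln_gt0.
have K4 : 0 < K %/ (4 * c).
  rewrite divn_gt0 //; apply: leq_trans KK; apply: leq_trans (leq_addr _ _).
  by rewrite leq_pmulr // expn_gt0.
pose q := trunc_log 3 (K %/ (4 * c)); exists q.
have [q1 q2] : 4 * c * 3 ^ q <= K /\ K < 4 * c * 3 ^ q.+1.
  have /andP[h1 h2] := trunc_log_bounds (isT : 1 < 3) K4; split.
    apply: leq_trans (leq_trunc_div K (4 * c)); rewrite [leqRHS]mulnC leq_mul2l.
    by rewrite h1 orbT.
  by move: h2; rewrite ltn_divLR // mulnC.
have qC : 18 * C + 3 <= q.
  rewrite -ltnS -(ltn_exp2l _ _ (isT : 1 < 3)) -(ltn_pmul2l c4).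
  apply: leq_ltn_trans q2; apply: leq_trans KK; exact: leq_addr.
have h := linear_exp3_le_exp4 qC.
have x_gt0 : 0 < 3 ^ q by rewrite expn_gt0.
have qK : 3 ^ q <= K by nia.
split => //.
  have -> : 2 ^ (q + q).+1 = 2 * 4 ^ q by rewrite expnS addnn -mul2n expnM.
  move: q2 h x_gt0; rewrite expnS /C; set x := 3 ^ q; set y := 4 ^ q => q2 h x_gt0.
  have h1 : c * (K.+1 * (q + q).+1 + K) <= c * (12 * c * x * (2 * q.+1)).
    rewrite leq_mul2l; apply/orP; right.
    have h2 : K.+1 <= 12 * c * x by nia.
    apply: leq_trans (_ : K.+1 * (2 * q.+1) <= _); first by nia.
    by rewrite leq_mul2r h2 orbT.
  have h3 : c * (12 * c * x * (2 * q.+1)) = 24 * c ^ 2 * q.+1 * x by nia.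
  have y0 : 0 < y by rewrite expn_gt0.
  by rewrite h3 in h1; apply: leq_trans h1 _; apply: leq_trans h _; lia.
(* As [u] takes up at most a quarter of the exponent [K], the remaining [2 ^ (K - u)] still
   dominates the quadratic in [K]. *)
set u := c * 3 ^ q; have uK : 4 * u <= K by rewrite /u mulnA.
have -> : 2 ^ K = 2 ^ u * 2 ^ (K - u) by rewrite -expnD subnKC //; lia.
have u0 : 0 < 2 ^ u by rewrite expn_gt0.
have K10 : 10 <= K./2 by lia.
have h1 := quadratic_le_exp2 K10.
have h2 : 2 ^ K./2 <= 2 ^ (K - u) by rewrite leq_exp2l //; lia.
have h3 : 2 * K ^ 2 + 2 * K + K <= 2 ^ (K - u).
  apply: leq_trans h2; apply: leq_trans h1.
  have : K <= (2 * K./2).+1 by lia.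
  by set m := (2 * _).+1; nia.
apply: leq_trans (_ : 2 ^ u * (2 * K ^ 2 + 2 * K + K) <= _); first by nia.
by rewrite leq_mul2l h3 orbT.
Qed.

(** For [n <= 2 ^ K.+1] the left side is the exponent of [2] that bounds [n ^ k * 2 ^ (k * k)], with
    [K] to spare. *)
Lemma exponent_sum_le k K : k <= K -> K.+1 * k + k * k + K <= 2 * K ^ 2 + 2 * K.
Proof.
move=> kK; have : K.+1 * k <= K.+1 * K by rewrite leq_mul2l kK orbT.
have : k * k <= K * K by exact: leq_mul.
by rewrite -mulnn !mulSn; lia.
Qed.

From mathcomp Require Import all_classical all_reals all_analysis.
Import Order.TTheory GRing.Theory Num.Theory.
Import numFieldNormedType.Exports.
Local Open Scope classical_set_scope.
Local Open Scope ring_scope.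

(** * Continuity on subspaces *)

Section Within.
Context {R : realType}.

Lemma row_continuous (S : topologicalType) (n : nat) (f : S -> 'rV[R]_n) :
  (forall i, continuous (fun x => f x ord0 i)) -> continuous f.
Proof.
move=> fc x; apply/cvg_ballP => e e0.
have H : \forall y \near x, forall i, ball (f x ord0 i) e (f y ord0 i).
  by apply: filter_forall => i; have /cvg_ballP := fc i x; apply.
near=> y; split => // i j; rewrite ord1; move: j.
by near: y.
Unshelve. all: by end_near. Qed.

Lemma within_comp (S U W : topologicalType) (A : set S) (B : set U)
    (f : S -> U) (g : U -> W) :
  (forall x, A x -> B (f x)) ->
  {within A, continuous f} -> {within B, continuous g} ->
  {within A, continuous (g \o f)}.
Proof.
move=> AB /subspace_continuousP fc /subspace_continuousP gc.
apply/subspace_continuousP => x Ax P /(gc _ (AB _ Ax)) /= gP.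
have := fc x Ax _ gP; rewrite /= /nbhs /= /within /=.
by move=> H; near=> y => Ay; apply: (near H y) => //; exact: AB.
Unshelve. all: by end_near. Qed.

Lemma within_pair (S U W : topologicalType) (A : set S)
    (f : S -> U) (g : S -> W) :
  {within A, continuous f} -> {within A, continuous g} ->
  {within A, continuous (fun x => (f x, g x))}.
Proof. by move=> fc gc x; apply: cvg_pair; [exact: fc | exact: gc]. Qed.

Lemma within_row (S : topologicalType) (A : set S) (n : nat)
    (f : S -> 'rV[R]_n) :
  (forall i, {within A, continuous (fun x => f x ord0 i)}) ->
  {within A, continuous f}.
Proof. by move=> fc; apply: row_continuous => i; exact: fc. Qed.

Lemma within_coord (S : topologicalType) (A : set S) (n : nat)
    (f : S -> 'rV[R]_n) i :
  {within A, continuous f} -> {within A, continuous (fun x => f x ord0 i)}.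
Proof.
move=> fc x.
apply: (@continuous_comp (subspace A) _ R f (fun M : 'rV[R]_n => M ord0 i)).
  exact: fc.
exact: coord_continuous.
Qed.


Lemma within_min (S : topologicalType) (A : set S) (f g : S -> R) :
  {within A, continuous f} -> {within A, continuous g} ->
  {within A, continuous (fun x => Num.min (f x) (g x))}.
Proof.
by move=> fc gc x; apply: (@continuous_min _ (subspace A)); [exact: fc | exact: gc].
Qed.

Lemma within_max (S : topologicalType) (A : set S) (f g : S -> R) :
  {within A, continuous f} -> {within A, continuous g} ->
  {within A, continuous (fun x => Num.max (f x) (g x))}.
Proof.
by move=> fc gc x; apply: (@continuous_max _ (subspace A)); [exact: fc | exact: gc].
Qed.

Lemma within_big (S : topologicalType) (A : set S) (I : Type) (r : seq I)
    (P : pred I) (op : R -> R -> R) (x0 : S -> R) (F : I -> S -> R) :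
  (forall f g, {within A, continuous f} -> {within A, continuous g} ->
    {within A, continuous (fun x => op (f x) (g x))}) ->
  {within A, continuous x0} -> (forall i, {within A, continuous (F i)}) ->
  {within A, continuous (fun x => \big[op/x0 x]_(i <- r | P i) F i x)}.
Proof.
move=> opc x0c Fc; elim: r => [|i r IHr].
  rewrite (_ : (fun _ => _) = x0) //.
  by apply/funext => x; rewrite big_nil.
rewrite (_ : (fun _ => _) = (fun x => if P i
    then op (F i x) (\big[op/x0 x]_(j <- r | P j) F j x)
    else \big[op/x0 x]_(j <- r | P j) F j x)).
  by case: (P i) => //; exact: opc.
by apply/funext => x; rewrite big_cons.
Qed.

Lemma within_add (S : topologicalType) (A : set S) (f g : S -> R) :
  {within A, continuous f} -> {within A, continuous g} ->
  {within A, continuous (fun x => f x + g x)}.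
Proof. by move=> fc gc x; apply: cvgD; [exact: fc | exact: gc]. Qed.

Lemma within_sub (S : topologicalType) (A : set S) (f g : S -> R) :
  {within A, continuous f} -> {within A, continuous g} ->
  {within A, continuous (fun x => f x - g x)}.
Proof. by move=> fc gc x; apply: cvgB; [exact: fc | exact: gc]. Qed.

Lemma within_mul (S : topologicalType) (A : set S) (f g : S -> R) :
  {within A, continuous f} -> {within A, continuous g} ->
  {within A, continuous (fun x => f x * g x)}.
Proof. by move=> fc gc x; apply: cvgM; [exact: fc | exact: gc]. Qed.

Lemma within_cst (S U : topologicalType) (A : set S) (a : U) :
  {within A, continuous (fun _ => a)}.
Proof. by move=> x; exact: cvg_cst. Qed.

Lemma within_global (S U : topologicalType) (A : set S) (f : S -> U) :
  continuous f -> {within A, continuous f}.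
Proof. by move=> fc; exact: continuous_subspaceT. Qed.

Lemma within_eq (S U : topologicalType) (A : set S) (f g : S -> U) :
  (forall x, A x -> f x = g x) ->
  {within A, continuous f} -> {within A, continuous g}.
Proof.
move=> fg; apply: subspace_eq_continuous => x; rewrite inE => Ax.
exact: fg.
Qed.

(** The pasting lemma for two closed pieces. *)
Lemma within_if (S U : topologicalType) (A B : set S) (f g : S -> U) :
  closed A -> closed B ->
  {within A, continuous f} -> {within B, continuous g} ->
  (forall x, A x -> B x -> f x = g x) ->
  {within A `|` B, continuous (fun x => if x \in A then f x else g x)}.
Proof.
move=> cA cB fc gc fg; apply: withinU_continuous => //.
  by apply: within_eq fc => x Ax; rewrite mem_set.
apply: within_eq gc => x Bx.
by case: ifPn => //; rewrite inE => Ax; rewrite fg.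
Qed.

End Within.

(** * Contracting skeleta of conic complexes *)

Section Cone.
Context {R : realType} {n : nat}.
Implicit Types (x y : 'rV[R]_n) (s t r : {set 'I_n}) (K Z : {set {set 'I_n}}).

Definition supp x : {set 'I_n} := [set i | x ord0 i != 0]%SET.

Lemma supp0 : supp 0 = finset.set0.
Proof. by apply/setP => i; rewrite !finset.inE mxE eqxx. Qed.

Lemma supp_eq0 x : supp x = finset.set0 -> x = 0.
Proof.
move=> x0; apply/rowP => i; apply/eqP; rewrite mxE.
by have /setP/(_ i) := x0; rewrite !finset.inE => /negbFE.
Qed.

(** Coordinates are left unnormalised, which postpones all division; the origin belongs to the cone
    whenever [K] contains the empty face. *)
Definition cone K : set 'rV[R]_n :=
  [set x : 'rV[R]_n | (forall i, 0 <= x ord0 i) /\ supp x \in K].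

Lemma cone_sub K t x : down_closed K -> t \in K ->
  (forall i, 0 <= x ord0 i) -> (forall i, i \notin t -> x ord0 i = 0) -> cone K x.
Proof.
move=> dK tK x0 xt; split => //; apply: dK tK; apply/fintype.subsetP => i.
by rewrite finset.inE; apply: contraNT => /xt ->.
Qed.

(** A finite union of closed sets, one for each face [t] of [K]: by downward closure, having support
    [t] may be relaxed to vanishing off [t]. *)
Lemma closed_cone K : down_closed K -> closed (cone K).
Proof.
move=> dK.
have -> : cone K = \bigcup_(t in [set` K])
    ([set x : 'rV[R]_n | forall i, 0 <= x ord0 i] `&`
     [set x : 'rV[R]_n | forall i, i \notin t -> x ord0 i = 0]).
  apply/seteqP; split => [x [x0 xK]|x [t tK [x0 xt]]].
    exists (supp x) => //; split => // i.
    by rewrite finset.inE negbK => /eqP.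
  exact: cone_sub xt.
apply: closed_bigcup => [|t _]; first exact: finite_finset.
apply: closedI.
  have -> : [set x : 'rV[R]_n | forall i, 0 <= x ord0 i] =
      \bigcap_(i in [set: 'I_n]) ((fun x : 'rV[R]_n => x ord0 i) @^-1` [set z | 0 <= z]).
    by apply/seteqP; split => x /= H i; [move=> _; exact: H | exact: H].
  apply: closed_bigI => i _; apply: closed_comp; last exact: closed_ge.
  by move=> x _; exact: coord_continuous.
have -> : [set x : 'rV[R]_n | forall i, i \notin t -> x ord0 i = 0] =
    \bigcap_(i in [set i | i \notin t])
      ((fun x : 'rV[R]_n => x ord0 i) @^-1` [set z | z = 0]).
  by apply/seteqP; split => x /= H i it; exact: H.
apply: closed_bigI => i _; apply: closed_comp; last exact: closed_eq.
by move=> x _; exact: coord_continuous.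
Qed.

(* A homotopy contracting the complex [K] inside [Z], in homogeneous
   coordinates: [(x, a)] with [a >= 0] is a point of the cone over [K] with
   weight [a] at the apex. *)
Definition cone_ext K Z := exists g : 'rV[R]_n * R -> 'rV[R]_n,
  [/\ {within [set z | cone K z.1 /\ 0 <= z.2], continuous g},
      forall x a, cone K x -> 0 <= a -> cone Z (g (x, a)),
      forall x, cone K x -> g (x, 0) = x &
      forall x a, cone K x -> 0 <= a -> g (x, a) = 0 -> a = 0].

(** For [i0] in [s] the default value is itself one of the minimised ones. *)
Definition min_on s i0 x := \big[Num.min/x ord0 i0]_(i in s) x ord0 i.

Lemma min_on_le s i0 x i : i \in s -> min_on s i0 x <= x ord0 i.
Proof. by move=> si; exact: bigmin_le_cond. Qed.

Lemma min_on_attained s i0 x : i0 \in s ->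
  exists2 i, i \in s & min_on s i0 x = x ord0 i.
Proof.
move=> i0s; rewrite /min_on; elim/big_ind : _ => [|a b|i si].
- by exists i0.
- by rewrite minEle; case: ifP.
- by exists i.
Qed.

Lemma closed_cone_time K (A : set R) : down_closed K -> closed A ->
  closed [set z : 'rV[R]_n * R | cone K z.1 /\ A z.2].
Proof.
move=> dK cA.
have -> : [set z : 'rV[R]_n * R | cone K z.1 /\ A z.2] =
  (fst @^-1` cone K) `&` (snd @^-1` A) by [].
apply: closedI.
  by apply: closed_comp (closed_cone dK) => x _; exact: cvg_fst.
by apply: closed_comp cA => x _; exact: cvg_snd.
Qed.

End Cone.

(** * Gluing a contraction across the star of a face *)

Section Glue.
Context {R : realType} {n : nat}.
Implicit Types (x y : 'rV[R]_n) (s t r : {set 'I_n}) (K Z Lk Lz : {set {set 'I_n}}).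

Lemma min_on_within (S : topologicalType) (A : set S) (f : S -> 'rV[R]_n) s i0 :
  {within A, continuous f} -> {within A, continuous (fun z => min_on s i0 (f z))}.
Proof.
move=> fc; apply: within_big => [g h gc hc||i]; first exact: within_min.
- exact: within_coord.
- exact: within_coord.
Qed.

Lemma within_fst (S U : topologicalType) (A : set (S * U)) :
  {within A, continuous fst}.
Proof. by apply: within_global => x; exact: cvg_fst. Qed.

Lemma within_snd (S U : topologicalType) (A : set (S * U)) :
  {within A, continuous snd}.
Proof. by apply: within_global => x; exact: cvg_snd. Qed.

(** Inside the star of [s] the apex weight is spent in two stages: first on the contraction [gL] of
    the link, up to the smallest coordinate over [s], at which moment the point enters the part of
    [K] without the open star; the rest is spent on [g']. *)
Lemma cone_ext_glue K Z Lk Lz s : s != finset.set0 ->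
  down_closed K -> down_closed Z ->
  (forall t, t :&: s = finset.set0 -> t :|: s \in K -> t \in Lk)%SET ->
  (forall t, t \in Lz -> t :|: s \in Z)%SET ->
  (forall t r, t \in Lz -> r \proper s ->
    t :|: r \in [set t in K | ~~ (s \subset t)])%SET ->
  cone_ext (R := R) Lk Lz ->
  cone_ext (R := R) [set t in K | ~~ (s \subset t)]%SET Z ->
  cone_ext (R := R) K Z.
Proof.
move=> s0 dK dZ KL LZ LK' [gL [gLc gLZ gL0 gLn]] [g' [g'c g'Z g'0 g'n]].
have [i0 i0s] := set0Pn _ s0.
set K' := [set t in K | _]%SET in LK' g'c g'Z g'0 g'n.
have dK' : down_closed K'.
  move=> t r rt; rewrite !finset.inE => /andP[tK st].
  by rewrite (dK _ _ rt tK) (contra _ st) // => /fintype.subset_trans; apply.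
(* The closed star of [s]. *)
pose Ks := [set t | t :|: s \in K]%SET.
have dKs : down_closed Ks.
  by move=> t r rt; rewrite !finset.inE; apply: dK; exact: finset.setSU.
pose a x := min_on s i0 x.
pose base x : 'rV[R]_n := \row_i (if i \in s then 0 else x ord0 i).
pose psi x m : 'rV[R]_n :=
  \row_i ((if i \in s then x ord0 i - m else 0) + gL (base x, m) ord0 i).
(* [psi x m] has traded the weight [m] of each vertex of [s] for the apex weight
   [m] of [gL]; at [m = a x] a vertex of [s] has disappeared, so that [g'] takes
   over with the remaining apex weight. *)
have base_cone x : cone Ks x -> cone Lk (base x).
  move=> [x0 xK]; split=> [i|]; first by rewrite mxE; case: ifP.
  apply: KL.
    by apply/setP => i; rewrite !finset.inE mxE; case: ifP; rewrite ?eqxx ?andbF.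
  suff -> : (supp (base x) :|: s = supp x :|: s)%SET by rewrite finset.inE in xK.
  apply/setP => i.
  by rewrite !finset.inE mxE; case: (i \in s); rewrite ?orbT.
have psi0 x : cone Ks x -> psi x 0 = x.
  move=> xK; apply/rowP => i; rewrite mxE gL0; last exact: base_cone.
  by rewrite mxE; case: ifP; rewrite ?subr0 ?addr0 ?add0r.
have psi_ge0 x m i : cone Ks x -> 0 <= m -> m <= a x ->
    0 <= (if i \in s then x ord0 i - m else 0) /\ 0 <= gL (base x, m) ord0 i.
  move=> xK m0 ma; split; last by have [] := gLZ _ _ (base_cone _ xK) m0.
  by case: ifP => // /(min_on_le i0 x) ax; rewrite subr_ge0 (le_trans ma).
have psiZ x m : cone Ks x -> 0 <= m -> m <= a x -> cone Z (psi x m).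
  move=> xK m0 ma; have [_ GL] := gLZ _ _ (base_cone _ xK) m0.
  apply: (cone_sub dZ (LZ _ GL)) => i.
    by rewrite mxE; have [? ?] := psi_ge0 _ _ i xK m0 ma; exact: addr_ge0.
  rewrite !finset.inE negb_or negbK => /andP[/eqP GE is'].
  by rewrite mxE (negPf is') add0r.
have a_ge0 x : (forall i, 0 <= x ord0 i) -> 0 <= a x.
  by move=> x0; rewrite /a; have [i _ ->] := min_on_attained x i0s.
have psiK' x : cone Ks x -> cone K' (psi x (a x)).
  move=> xK; have a0 : 0 <= a x by apply: a_ge0; case: xK.
  have [_ GL] := gLZ _ _ (base_cone _ xK) a0.
  have [i si ai] := min_on_attained x i0s.
  have pr : (s :\ i)%SET \proper s by rewrite properD1.
  apply: (cone_sub dK' (LK' _ _ GL pr)) => j.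
    by rewrite mxE; have [? ?] := psi_ge0 _ _ j xK a0 (lexx _); exact: addr_ge0.
  rewrite !finset.inE negb_or negbK => /andP[/eqP GE].
  rewrite mxE GE addr0 negb_and negbK => /orP[/eqP->|/negPf->//].
  by rewrite si -ai subrr.
have psi_eq0 x m : cone Ks x -> 0 <= m -> m <= a x -> psi x m = 0 -> m = 0.
  move=> xK m0 ma p0; apply: (gLn (base x)) => //; first exact: base_cone.
  apply/rowP => i; have /rowP/(_ i) := p0; rewrite !mxE.
  have [u v] := psi_ge0 _ _ i xK m0 ma.
  by move/eqP; rewrite paddr_eq0 // => /andP[_ /eqP].
have aK' x : cone K' x -> a x = 0.
  move=> [x0]; rewrite finset.inE => /andP[_ /subsetPn[i si]].
  rewrite finset.inE negbK => /eqP xi; apply/eqP; rewrite eq_le a_ge0 // andbT.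
  by rewrite -xi min_on_le.
(* [S1] and [S2] split the closed star at apex weight [a], and [S3] lies over [K']; all three are
   closed, as pasting requires. *)
pose S0 := [set z : 'rV[R]_n * R | cone Ks z.1 /\ 0 <= z.2].
pose S1 := S0 `&` [set z | 0 <= a z.1 - z.2].
pose S2 := S0 `&` [set z | 0 <= z.2 - a z.1].
pose S3 := [set z : 'rV[R]_n * R | cone K' z.1 /\ 0 <= z.2].
have nneg_closed (D : {set {set 'I_n}}) : down_closed D ->
    closed [set z : 'rV[R]_n * R | cone D z.1 /\ 0 <= z.2].
  move=> dD; exact: (closed_cone_time dD (@closed_ge R 0)).
have ac : continuous (fun z : 'rV[R]_n * R => a z.1).
  by apply/continuous_subspace_setT; apply: min_on_within; exact: within_fst.
have cS1 : closed S1.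
  apply: closedI; first exact: nneg_closed.
  apply: (@closed_comp _ _ (fun z : 'rV[R]_n * R => a z.1 - z.2)
    [set z | 0 <= z]) => [z _|].
    by apply: cvgB; [exact: ac | exact: cvg_snd].
  exact: closed_ge.
have cS2 : closed S2.
  apply: closedI; first exact: nneg_closed.
  apply: (@closed_comp _ _ (fun z : 'rV[R]_n * R => z.2 - a z.1)
    [set z | 0 <= z]) => [z _|].
    by apply: cvgB; [exact: cvg_snd | exact: ac].
  exact: closed_ge.
have cS3 : closed S3 by exact: nneg_closed.
have psic (S : topologicalType) (D : set S) (f : S -> 'rV[R]_n) (m : S -> R) :
    (forall z, D z -> cone Ks (f z) /\ 0 <= m z) ->
    {within D, continuous f} -> {within D, continuous m} ->
    {within D, continuous (fun z => psi (f z) (m z))}.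
  move=> Df fc mc; apply: within_row => i.
  apply: (@within_eq _ _ _ (fun z => (if i \in s then f z ord0 i - m z else 0) +
    gL (base (f z), m z) ord0 i)) => [z _|]; first by rewrite mxE.
  apply: within_add.
    case: (i \in s); last exact: within_cst.
    by apply: within_sub => //; exact: within_coord.
  apply: within_coord.
  apply: (@within_comp _ _ _ _ _ (fun z => (base (f z), m z)) gL _ _ gLc) => [z Dz|].
    by have [? ?] := Df _ Dz; split => //; exact: base_cone.
  apply: within_pair => //; apply: within_row => j.
  apply: (@within_eq _ _ _ (fun z => if j \in s then 0 else f z ord0 j)) => [z _|].
    by rewrite mxE.
  by case: (j \in s); [exact: within_cst | exact: within_coord].
pose f1 (z : 'rV[R]_n * R) := psi z.1 z.2.
pose f2 (z : 'rV[R]_n * R) := g' (psi z.1 (a z.1), z.2 - a z.1).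
pose g z := if z \in S1 then f1 z else if z \in S2 then f2 z else g' z.
(* When the weight equals [a], the second stage starts with apex weight [0], where [g'] returns its
   first argument. *)
have eqS2 z : S2 z -> z.2 = a z.1 -> f1 z = f2 z.
  move=> [[zK z0] _] za; rewrite /f2 -za subrr g'0 //.
  by rewrite za; exact: psiK'.
have gS1 z : S1 z -> g z = f1 z by move=> zS; rewrite /g mem_set.
have gS2 z : S2 z -> g z = f2 z.
  move=> zS2; rewrite /g; case: ifPn => [|_]; last by rewrite mem_set.
  rewrite inE => -[_ /=]; rewrite subr_ge0 => az; apply: eqS2 => //.
  by apply/eqP; rewrite eq_le az; case: zS2 => _ /=; rewrite subr_ge0 => ->.
(* Over [K'] the minimum [a] vanishes: a point of the closed star lies in [S2] with an empty first
   stage, and any other point lies in neither [S1] nor [S2]. *)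
have gS3 z : S3 z -> g z = g' z.
  move=> zS3; have [zK' z0] := zS3; have az := aK' _ zK'.
  have [zS2|nS2] := pselect (S2 z).
    rewrite gS2 // /f2 az subr0 psi0; first by case: (z).
    by case: zS2 => [[]].
  rewrite /g ifF; last first.
    apply/negP; rewrite inE => -[zKs _]; apply: nS2; split => //=.
    by rewrite az subr0.
  by rewrite ifF //; apply/negP; rewrite inE.
have cover z : cone K z.1 -> 0 <= z.2 -> [\/ S1 z, S2 z | S3 z].
  move=> [z0 zK] z2; have [sz|sz] := boolP (s \subset supp z.1).
    have zKs : cone Ks z.1.
      by split => //; rewrite finset.inE (finset.setUidPl sz).
    by case: (leP z.2 (a z.1)) => [h|/ltW h]; [apply: Or31 | apply: Or32]; split => //=;
      rewrite subr_ge0.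
  by apply: Or33; split => //; split => //; rewrite finset.inE zK.
exists g; split.
- apply: (@continuous_subspaceW _ _ _ (S1 `|` (S2 `|` S3))) => [z [zK z0]|].
    by case: (cover _ zK z0) => h; [left | right; left | right; right].
  apply: within_if => //; first exact: closedU.
  + apply: (@psic _ _ fst snd); [|exact: within_fst | exact: within_snd].
    by move=> z [].
  + apply: within_if => //.
    * apply: (@within_comp _ _ _ _ _
        (fun z => (psi z.1 (a z.1), z.2 - a z.1)) g' _ _ g'c).
        by move=> z [[zK z0] zle]; split => //; exact: psiK'.
      apply: within_pair.
        apply: psic; [|exact: within_fst | by apply: min_on_within; exact: within_fst].
        by move=> z [[zK z0] _]; split => //; apply: a_ge0; case: zK.
      by apply: within_sub; [exact: within_snd|apply: min_on_within; exact: within_fst].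
    * by move=> z zS2 zS3; rewrite -gS2 // gS3.
  + move=> z zS1 zS; rewrite -gS1 //; case: zS => zS.
      by rewrite mem_set //; exact: gS2.
    by case: ifPn => [|_]; [rewrite inE; exact: gS2 | exact: gS3].
- move=> x m xK m0; case: (cover (x, m) xK m0) => h.
  + by rewrite gS1 //; case: h => [[h1 _] /=]; rewrite subr_ge0 => h2; exact: psiZ.
  + by rewrite gS2 //; case: h => [[h1 _] h2]; apply: g'Z => //; exact: psiK'.
  + by rewrite gS3 //; case: h => h _; exact: g'Z.
- move=> x xK; case: (cover (x, 0) xK (lexx _)) => h.
  + by rewrite gS1 //; case: h => [[h1 _] _]; exact: psi0.
  + rewrite gS2 //; case: h => [[h1 _] /=]; rewrite subr_ge0 => h2.
    have a0 : a x = 0.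
      by apply/eqP; rewrite eq_le h2; apply: a_ge0; case: h1.
    have := psiK' _ h1; rewrite /f2 /= a0 subr0 psi0 //; exact: g'0.
  + by rewrite gS3 //; case: h => h _; exact: g'0.
- move=> x m xK m0; case: (cover (x, m) xK m0) => h.
  + by rewrite gS1 //; case: h => [[h1 _] /=]; rewrite subr_ge0 => h2; exact: psi_eq0.
  + rewrite gS2 // /f2 /=; case: h => [[/= h1 _]] h2 E; have hK := psiK' _ h1.
    have /eqP := g'n _ _ hK h2 E; rewrite subr_eq0 => /eqP ma.
    by move: E; rewrite ma subrr g'0 //; apply: psi_eq0 => //; rewrite -ma.
  + by rewrite gS3 //; case: h => h _; exact: g'n.
Qed.

End Glue.

(** * Contraction of the skeleton by successive removal of obstructions *)

Section ConicContractible.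
Context {R : realType} {n : nat}.
Implicit Types (x y : 'rV[R]_n) (s t r : {set 'I_n}) (F K Y Z : {set {set 'I_n}}).

(** In homogeneous coordinates, coning off with apex [v] just adds the apex weight to the coordinate
    [v]. *)
Lemma cone_ext_apex K Z (v : 'I_n) : down_closed Z ->
  (forall t, t \in K -> v |: t \in Z)%SET -> cone_ext (R := R) K Z.
Proof.
move=> dZ KZ.
exists (fun z : 'rV[R]_n * R => \row_i (z.1 ord0 i + z.2 *+ (i == v))); split.
- apply: within_row => i.
  apply: (@within_eq _ _ _ (fun z : 'rV[R]_n * R =>
      z.1 ord0 i + z.2 *+ (i == v))) => [z _|].
    by rewrite mxE.
  apply: within_add; first by apply: within_coord; exact: within_fst.
  by case: (i == v); [exact: within_snd | exact: within_cst].
- move=> x a [x0 xK] a0; apply: (cone_sub dZ (KZ _ xK)) => i.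
    by rewrite mxE addr_ge0 // mulrn_wge0.
  rewrite !finset.inE negb_or negbK => /andP[/negPf iv /eqP xi].
  by rewrite mxE /= iv xi addr0.
- by move=> x _; apply/rowP => i; rewrite mxE /= mul0rn addr0.
- move=> x a [x0 _] a0 /rowP/(_ v)/eqP; rewrite !mxE /= eqxx mulr1n.
  by rewrite paddr_eq0 // => /andP[_ /eqP].
Qed.

Lemma skeletonP (q : nat) F s : (s \in skeleton q F) = (s \in F) && (#|s| <= q)%N.
Proof. by rewrite finset.inE. Qed.

(** Conicity is applied to the one-member family of the empty face. *)
Lemma conic_vertex (T : finType) (k : nat) (F : {set {set T}}) :
  (0 < k)%N -> finset.set0 \in F -> conic k F ->
  exists v : T, (v |: finset.set0)%SET \in F.
Proof.
move=> k0 F0 cF.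
have [||||v vP] := cF (finset.set1 finset.set0).
- move=> s t ts; rewrite !finset.inE => /eqP s0; move: ts.
  by rewrite s0 finset.subset0.
- by rewrite !finset.inE.
- by rewrite finset.sub1set.
- by rewrite finset.cards1.
- by exists v; have [] := vP finset.set0; rewrite ?finset.inE.
Qed.

(** The outer induction on [q] serves the links, the inner one on the size of [Y] the removal of
    obstructions. Contracting adds one vertex, whence the target [q.+1]; gluing still meets the
    [q]-skeleton, since a proper face of [s] has lost a vertex in exchange. *)
Lemma conic_cone_ext (q : nat) F : down_closed F -> finset.set0 \in F ->
  conic (3 ^ q) F -> cone_ext (R := R) (skeleton q F) (skeleton q.+1 F).
Proof.
elim/ltn_ind: q F => q IH F dF F0 cF.
have [|v vF] := conic_vertex _ F0 cF; first by rewrite expn_gt0.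
(* [Y] keeps every face joinable to [v], and each face of [F] outside [Y] contains a minimal
   obstruction outside [Y]; the latter is what [conic_residual] consumes. *)
suff H (m : nat) Y : (#|Y| <= m)%N -> down_closed Y -> Y \subset F ->
    (forall t, t \in F -> (v |: t)%SET \in F -> t \in Y) ->
    (forall t, t \in F -> t \notin Y -> exists s',
      [/\ s' \subset t, s' \notin Y & minimal_obstruction F v s']) ->
    cone_ext (R := R) (skeleton q Y) (skeleton q.+1 F).
  by apply: (H _ F (leqnn _)) => // t ->.
elim: m Y => [|m IHm] Y Ym dY YF linkY FY.
  have Y0 : finset.set0 \in Y by exact: linkY.
  by move: Ym; rewrite leqn0 cards_eq0 => /eqP YE; rewrite YE finset.inE in Y0.
(* Once all remaining faces of the skeleton are joinable to [v], the apex [v] contracts it;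
   otherwise a minimal non-joinable face [s] is removed. *)
have [/forall_inP H|] := boolP [forall s in skeleton q Y, v |: s \in F]%SET.
  apply: (cone_ext_apex (v := v)); first exact: down_closed_skeleton.
  move=> t tY; rewrite skeletonP (H _ tY) /=.
  move: tY; rewrite skeletonP => /andP[_ tq].
  by rewrite (leq_trans (leq_card_setU _ _)) // finset.cards1 add1n ltnS.
rewrite negb_forall_in => /exists_inP[u]; rewrite skeletonP => /andP[uY uq] uv.
have [s /minsetP[sv smin] su] := @minset_exists _ (fun s => (v |: s)%SET \notin F) u uv.
have sF : minimal_obstruction F v s.
  split => // r rs; apply/negPn/negP => rv.
  by have := rs; rewrite (smin r rv (proper_sub rs)) fintype.properxx.
have sY : s \in Y by exact: dY uY.
have sq : (#|s| <= q)%N by exact: leq_trans (subset_leq_card su) uq.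
have s0 : s != finset.set0 by apply: contraNneq sv => ->.
pose Y' := [set t in Y | ~~ (s \subset t)]%SET.
have dY' : down_closed Y'.
  move=> t r rt; rewrite !finset.inE => /andP[tY st].
  by rewrite (dY _ _ rt tY) (contra _ st) // => /fintype.subset_trans; apply.
have Y'Y : Y' \subset Y by apply/fintype.subsetP => t; rewrite finset.inE => /andP[].
have Y'F := fintype.subset_trans Y'Y YF.
have linkY' t : t \in F -> (v |: t)%SET \in F -> t \in Y'.
  move=> tF vtF; rewrite finset.inE linkY //=; apply: contra sv => st.
  by apply: dF vtF; exact: finset.setUS.
have FY' t : t \in F -> t \notin Y' -> exists s',
    [/\ s' \subset t, s' \notin Y' & minimal_obstruction F v s'].
  move=> tF; rewrite finset.inE negb_and negbK => /orP[/(FY _ tF)[s' [s't s'Y s'F]]|st].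
    by exists s'; split => //; apply: contra s'Y => /(fintype.subsetP Y'Y).
  by exists s; split => //; rewrite finset.inE fintype.subxx andbF.
have skE : skeleton q Y' = [set t in skeleton q Y | ~~ (s \subset t)]%SET.
  by apply/setP => t; rewrite !finset.inE andbAC.
have s_gt0 : (0 < #|s|)%N by rewrite card_gt0.
pose L := residual F Y' s.
have dL : down_closed L by exact: down_closed_residual.
apply: (@cone_ext_glue _ _ _ _
  (skeleton (q - #|s|) L) (skeleton (q - #|s|).+1 L) s) => //.
- exact: down_closed_skeleton.
- exact: down_closed_skeleton.
- move=> t ts; rewrite skeletonP => /andP[tsY tsq]; rewrite skeletonP.
  apply/andP; split; last first.
    by move: tsq; rewrite cardsU ts cards0 subn0 leq_subRL // addnC.
  apply/residualP; split => // [|r rs]; first exact: (fintype.subsetP YF).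
  rewrite finset.inE (dY _ _ (finset.setUS _ (proper_sub rs)) tsY) /=.
  apply: contraNN (proper_subn rs) => str.
  apply/fintype.subsetP => i si; have := fintype.subsetP str _ si.
  rewrite finset.inE => /orP[ti|//].
  by have /setP/(_ i) := ts; rewrite !finset.inE ti si.
- move=> t; rewrite skeletonP => /andP[/residualP[_ tsF _] tq].
  rewrite skeletonP tsF /= (leq_trans (leq_card_setU _ _)) //.
  by rewrite (leq_trans (leq_add tq (leqnn _))) // addSn subnK.
- move=> t r; rewrite skeletonP => /andP[/residualP[_ _ tY] tq] rs.
  rewrite -skE skeletonP tY //= (leq_trans (leq_card_setU _ _)) //.
  rewrite (leq_trans (leq_add tq (leqnn _))) // addSnnS.
  by rewrite (leq_trans (leq_add (leqnn _) (proper_card rs))) // subnK.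
(* The link falls under the outer induction hypothesis, as [s] is non-empty and
   [3 ^ q = 3 ^ #|s| * 3 ^ (q - #|s|)]. *)
- apply: IH => //; first by rewrite -subn_gt0 subKn.
    apply/residualP; split; rewrite ?finset.set0U ?finset.set0I //.
      exact: (fintype.subsetP YF).
    move=> r rs; rewrite finset.set0U; apply: linkY'; last by case: sF => _; apply.
    by apply: dF (proper_sub rs) _; exact: (fintype.subsetP YF).
  apply: conic_residual sF FY' _ => //; first exact: (fintype.subsetP YF).
  by rewrite -expnD subnKC.
- rewrite -skE; apply: IHm => //.
  rewrite -ltnS (leq_trans _ Ym) // proper_card // fintype.properE Y'Y.
  by apply/subsetPn; exists s => //; rewrite finset.inE fintype.subxx andbF.
Qed.

End ConicContractible.

(** * The two categorical open sets *)

Section NullHomotopy.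
Context {R : realType} {n : nat}.
Implicit Types (x y : 'rV[R]_n) (s t r : {set 'I_n}).

Lemma within_inv (S : topologicalType) (A : set S) (f : S -> R) :
  (forall z, A z -> f z != 0) -> {within A, continuous f} ->
  {within A, continuous (fun z => (f z)^-1)}.
Proof.
move=> f0 /subspace_continuousP fc; apply/subspace_continuousP => x Ax.
by apply: cvgV; [exact: f0 | exact: fc].
Qed.

Lemma within_set_type (S T : topologicalType) (A : set S) (B : set T)
    (f : S -> B) :
  {within A, continuous (fun z => set_val (f z))} -> {within A, continuous f}.
Proof.
move=> /continuousP fc; apply/continuousP => _ [W oW <-].
exact: fc.
Qed.

(** The empty face, which [simplices] excludes, is adjoined so that the family becomes
    down-closed. *)
Definition faces (X : subcomplex n) : {set {set 'I_n}} :=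
  (finset.set0 |: simplices X)%SET.

Lemma down_closed_faces X : down_closed (faces X).
Proof.
move=> s t ts; rewrite !finset.inE; have [->//|t0] := eqVneq t finset.set0.
have /forall_inP H := subcomplexP X.
case/orP => [/eqP s0|/H/andP[_ /forallP/(_ t)]].
  by move: ts t0; rewrite s0 finset.subset0 => ->.
by rewrite ts t0.
Qed.

Lemma faces0 X : finset.set0 \in faces X.
Proof. by rewrite !finset.inE eqxx. Qed.

Definition mass x := \sum_i x ord0 i.

Definition normalize x : 'rV[R]_n := (mass x)^-1 *: x.

Lemma mass_gt0 x : (forall i, 0 <= x ord0 i) -> x != 0 -> 0 < mass x.
Proof.
move=> x0 xn0; rewrite lt_neqAle sumr_ge0 // andbT eq_sym.
apply: contra_neq xn0 => m0; apply/rowP => i; rewrite mxE.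
by apply: (psumr_eq0P _ m0).
Qed.

(* [realization R X] is convertible to [set_type (simplex_points X)]. *)
Definition simplex_points (X : subcomplex n) : set 'rV[R]_n :=
  [set x : 'rV[R]_n | [/\ forall i, 0 <= x ord0 i, \sum_i x ord0 i = 1 &
        [set i | x ord0 i != 0]%SET \in simplices X]].

Lemma normalize_simplex (X : subcomplex n) x : cone (faces X) x -> x != 0 ->
  simplex_points X (normalize x).
Proof.
move=> [x0 xF] xn0; have m0 := mass_gt0 x0 xn0; split.
- by move=> i; rewrite mxE mulr_ge0 // invr_ge0 ltW.
- under eq_bigr do rewrite mxE.
  by rewrite -mulr_sumr mulVf // gt_eqF.
have -> : [set i | normalize x ord0 i != 0]%SET = supp x.
  by apply/setP => i; rewrite !finset.inE mxE mulf_eq0 invr_eq0 gt_eqF.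
move: xF; rewrite !finset.inE => /orP[/eqP /supp_eq0 x00|//].
by rewrite x00 eqxx in xn0.
Qed.

(** The segment from a point to its image under [f] stays in one face. Then the apex weight grows
    from [0] to [1] while [f] is scaled down to [0], so the end point [g (0, 1)] is the same for all
    points. *)
Lemma null_homotopic_skeleton (X : subcomplex n) (q : nat) (U : set (realization R X))
    (f : realization R X -> 'rV[R]_n) :
  cone_ext (R := R) (skeleton q (faces X)) (skeleton q.+1 (faces X)) ->
  {within U, continuous f} ->
  (forall z, U z -> [/\ forall i, 0 <= f z ord0 i, f z != 0,
     supp (f z) \subset supp (val z) & (#|supp (f z)| <= q)%N]) ->
  null_homotopic R (set_val : U -> realization R X).
Proof.
set F := faces X; have dF : down_closed F := @down_closed_faces X.
move=> [g [gc gF g0 gn]] fc fU.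
have sk0 : cone (skeleton q F) (0 : 'rV[R]_n).
  by split => [i|]; rewrite ?mxE // supp0 skeletonP cards0 faces0.
have skF k y : cone (skeleton k F) y -> cone F y.
  by move=> [y0]; rewrite skeletonP => /andP[].
have g01 : simplex_points X (normalize (g (0, 1))).
  apply: normalize_simplex; first exact: skF (gF _ _ sk0 ler01).
  by apply/eqP => /(gn _ _ sk0 ler01)/eqP; rewrite oner_eq0.
exists (exist (fun y => y \in simplex_points X) _ (mem_set g01) : realization R X).
pose x (z : realization R X) : 'rV[R]_n := \val z.
(* First the straight line from [x] to [f], then the contraction [g]. *)
pose arg (w : U * R) : 'rV[R]_n * R :=
  (Num.min (2 * w.2) (2 - 2 * w.2) *: f (set_val w.1), Num.max (2 * w.2 - 1) 0).
(* The truncations let one formula cover both halves: up to time one half the apex weight is [0] and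
   [g] returns its first argument, afterwards the term in [x] vanishes. *)
pose H0 (w : U * R) : 'rV[R]_n :=
  Num.max (1 - 2 * w.2) 0 *: x (set_val w.1) + g (arg w).
(* At times in [[0, 1]] the default of [insubd] is never reached, by [H0P]. *)
pose H (w : U * R) : realization R X := insubd (set_val w.1) (normalize (H0 w)).
have xP (z : realization R X) : simplex_points X (x z) by exact: set_valP.
have fcone (z : U) c : 0 <= c -> cone (skeleton q F) (c *: f (set_val z)).
  move=> c0; have [fz0 _ fzx fzq] := fU _ (set_valP z).
  have [_ _ xX] := xP (set_val z).
  have fzF : supp (f (set_val z)) \in skeleton q F.
    rewrite skeletonP fzq andbT; apply: (dF _ _ fzx).
    by rewrite finset.inE [X in _ || X]xX orbT.
  apply: (cone_sub (down_closed_skeleton dF) fzF) => i; rewrite mxE.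
    exact: mulr_ge0.
  by rewrite finset.inE negbK => /eqP->; rewrite mulr0.
have H0P (w : U * R) : 0 <= w.2 <= 1 -> cone F (H0 w) /\ H0 w != 0.
  case: w => z t /= /andP[t0 t1]; rewrite /H0 /arg /=.
  have [fz0 fzn0 fzx fzq] := fU _ (set_valP z).
  have [x0 x1 xX] := xP (set_val z).
  have [t2|t2] := ltP t 2^-1.
    rewrite (max_l (_ : 0 <= 1 - 2 * t)); last lra.
    rewrite (min_l (_ : 2 * t <= 2 - 2 * t)); last lra.
    rewrite (max_r (_ : 2 * t - 1 <= 0)); last lra.
    rewrite g0; last by apply: fcone; lra.
    have c1 : 0 < 1 - 2 * t by lra.
    have c2 : 0 <= 2 * t by lra.
    have xF : supp (x (set_val z)) \in F by rewrite finset.inE [X in _ || X]xX orbT.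
    split.
      apply: (cone_sub dF xF) => i; rewrite !mxE.
        by rewrite addr_ge0 // mulr_ge0 // ltW.
      move=> xi; have fi : i \notin supp (f (set_val z)).
        by apply: contra xi; exact: fintype.subsetP.
      move: xi fi; rewrite !finset.inE !negbK => /eqP-> /eqP->.
      by rewrite !mulr0 addr0.
    apply/eqP => /rowP E; have : \sum_i x (set_val z) ord0 i = 0.
      apply: big1 => i _; have := E i; rewrite !mxE => /eqP.
      rewrite paddr_eq0 ?mulr_ge0 // ?ltW // mulf_eq0 (gt_eqF c1) /=.
      by case/andP => /eqP.
    by rewrite x1 => /eqP; rewrite oner_eq0.
  rewrite (max_r (_ : 1 - 2 * t <= 0)); last lra.
  rewrite (min_r (_ : 2 - 2 * t <= 2 * t)); last lra.
  rewrite (max_l (_ : 0 <= 2 * t - 1)); last lra.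
  rewrite scale0r add0r.
  have c1 : 0 <= 2 - 2 * t by lra.
  have c2 : 0 <= 2 * t - 1 by lra.
  split; first exact: skF (gF _ _ (fcone z _ c1) c2).
  (* A zero of [g] forces apex weight [0], that is time one half, where the value is the non-zero
     [f]. *)
  apply/eqP => E; have := gn _ _ (fcone z _ c1) c2 E => tE.
  move: E; rewrite tE g0; last exact: fcone.
  have -> : 2 - 2 * t = 1 by lra.
  by rewrite scale1r => /eqP; rewrite (negPf fzn0).
have HE (w : U * R) : 0 <= w.2 <= 1 -> set_val (H w) = normalize (H0 w).
  move=> /H0P[HF Hn]; rewrite /H set_valE insubdK //.
  exact/mem_set/normalize_simplex.
pose D : set (U * R) := [set: U] `*` `[0, 1]%classic.
have DP (w : U * R) : D w -> 0 <= w.2 <= 1 by case=> _ /=; rewrite in_itv.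
exists H; split.
- apply: within_set_type.
  apply: (@within_eq _ _ D (fun w => normalize (H0 w))) => [w /DP w01|].
    by rewrite HE.
  have sndc : {within D, continuous (snd : U * R -> R)} by exact: within_snd.
  have z_c : {within D, continuous (fun w : U * R => set_val w.1 : realization R X)}.
    apply: within_global => w; apply: continuous_comp; first exact: cvg_fst.
    exact: initial_continuous.
  have f_c : {within D, continuous (fun w : U * R => f (set_val w.1))}.
    apply: (@within_comp _ _ _ _ _
      (fun w : U * R => set_val w.1 : realization R X) f _ z_c fc).
    by move=> w _; exact: set_valP.
  have x_c : {within D, continuous (fun w : U * R => x (set_val w.1))}.
    apply: (@within_comp _ _ _ _ setT
      (fun w : U * R => set_val w.1 : realization R X) x _ z_c) => //.
    by apply: within_global; exact: initial_continuous.
  have fac_c : {within D, continuous (fun w : U * R => Num.max (1 - 2 * w.2) 0)}.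
    apply: within_max; last exact: within_cst.
    apply: within_sub; first exact: within_cst.
    by apply: within_mul => //; exact: within_cst.
  have H0c : {within D, continuous H0}.
    apply: within_row => i.
    apply: (@within_eq _ _ D (fun w : U * R =>
        Num.max (1 - 2 * w.2) 0 * x (set_val w.1) ord0 i + g (arg w) ord0 i)).
      by move=> w _; rewrite !mxE.
    apply: within_add; [apply: within_mul|apply: within_coord].
    + exact: fac_c.
    + exact: within_coord.
    + apply: (@within_comp _ _ _ _ _ arg g _ _ gc).
        move=> w /DP/andP[w0 w1]; split => /=; last by rewrite le_max lexx orbT.
        by apply: fcone; rewrite le_min; apply/andP; split; lra.
      have c2 : {within D, continuous (fun w : U * R => 2 * w.2)}.
        by apply: within_mul => //; exact: within_cst.
      apply: within_pair; last first.
        by apply: within_max; [apply: within_sub => //|]; exact: within_cst.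
      apply: within_row => j.
      apply: (@within_eq _ _ D (fun w : U * R =>
          Num.min (2 * w.2) (2 - 2 * w.2) * f (set_val w.1) ord0 j)).
        by move=> w _; rewrite mxE.
      apply: within_mul; last exact: within_coord.
      by apply: within_min => //; apply: within_sub => //; exact: within_cst.
  apply: within_row => i.
  apply: (@within_eq _ _ D (fun w => (mass (H0 w))^-1 * H0 w ord0 i)).
    by move=> w _; rewrite [RHS]mxE.
  apply: within_mul; last exact: within_coord.
  apply: within_inv => [w /DP/H0P[[h1 h2] h3]|].
    by rewrite gt_eqF //; exact: mass_gt0.
  apply: within_big => [a b ac bc||j]; [exact: within_add|exact: within_cst|].
  exact: within_coord.
- move=> z; apply: val_inj; rewrite -set_valE HE ?lexx ?ler01 // /H0 /arg /=.
  rewrite mulr0 subr0 max_l // scale1r subr0 min_l // scale0r sub0r max_r // g0 // addr0.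
  rewrite /normalize; have [_ x1 _] := xP (set_val z).
  by rewrite /mass x1 invr1 scale1r.
- move=> z; apply: val_inj; rewrite -set_valE HE ?lexx ?ler01 // /H0 /arg /=.
  rewrite mulr1 max_r ?scale0r ?add0r; last lra.
  rewrite subrr min_r // scale0r max_l; last lra.
  by have -> : 2 - 1 = 1 :> R by lra.
Qed.

End NullHomotopy.

(** * Order statistics and the cover by two open sets *)

Section CategoricalCover.
Context {R : realType} {n : nat}.
Implicit Types (x y : 'rV[R]_n) (s t r : {set 'I_n}).

(* On the standard simplex this is the [k]-th largest coordinate: the default
   values [0] and [1] do not matter, as they bound all coordinates. *)
Definition order_stat k x : R :=
  \big[Num.max/0]_(s : {set 'I_n} | #|s| == k)
    \big[Num.min/1]_(i in s) x ord0 i.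

Lemma order_stat_ge0 k x : 0 <= order_stat k x.
Proof. exact: bigmax_ge_id. Qed.

(** Otherwise [k.+1] of these coordinates would have a minimum above the maximum of all such minima.
    The bound by [1] takes care of the default value of the minimum. *)
Lemma card_gt_order_stat k x : (forall i, x ord0 i <= 1) ->
  (#|[set i | (order_stat k.+1 x < x ord0 i)%R]%SET| <= k)%N.
Proof.
move=> x1; rewrite leqNgt; apply/negP => /card_geqP[l [lu lk lx]].
pose s : {set 'I_n} := [set i in l]%SET.
have sk : #|s| == k.+1 by rewrite cardsE (card_uniqP lu) lk.
have [i0 i0s] : exists i, i \in s.
  by apply/set0Pn; rewrite -card_gt0 (eqP sk).
have slt i : i \in s -> order_stat k.+1 x < x ord0 i.
  by rewrite finset.inE => /lx; rewrite finset.inE.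
have : order_stat k.+1 x < \big[Num.min/1]_(i in s) x ord0 i.
  apply/bigmin_gtP; split; last by [].
  exact: lt_le_trans (slt _ i0s) (x1 _).
apply/negP; rewrite -leNgt.
exact: (le_bigmax_cond _ (fun s : {set 'I_n} => \big[Num.min/1]_(i in s) x ord0 i)).
Qed.

(** Positivity excludes the default [0], so the maximum is reached by a set of [k] indices. *)
Lemma order_stat_attained k x : 0 < order_stat k x ->
  (k <= #|[set i | (order_stat k x <= x ord0 i)%R]%SET|)%N.
Proof.
move=> h0.
suff [s /eqP sk hs] : exists2 s : {set 'I_n}, #|s| == k &
    order_stat k x <= \big[Num.min/1]_(i in s) x ord0 i.
  rewrite -{1}sk; apply/subset_leq_card/fintype.subsetP => i si.
  by rewrite finset.inE; apply: le_trans hs _; exact: bigmin_le_cond.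
apply: contrapT => H.
have : order_stat k x < order_stat k x; last by rewrite ltxx.
apply: bigmax_lt => // s sk; rewrite ltNge; apply/negP => hs.
by apply: H; exists s.
Qed.

Lemma within_order_stat (S : topologicalType) (A : set S) (f : S -> 'rV[R]_n) k :
  {within A, continuous f} -> {within A, continuous (fun z => order_stat k (f z))}.
Proof.
move=> fc; apply: within_big => [g h gc hc||s]; first exact: within_max.
  exact: within_cst.
apply: within_big => [g h gc hc||i]; first exact: within_min.
  exact: within_cst.
exact: within_coord.
Qed.

(** On the first set at most [q] coordinates exceed [h]. On the second at least [q + 1] coordinates
    reach [h] and at most one of these is a record; at most [q - 1] others remain, so again the
    support has at most [q] elements. *)
Lemma LScat_le1 (X : subcomplex n) (q : nat) :
  (forall s, s \in simplices X -> #|s| <= q + q)%N ->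
  conic (3 ^ q) (faces X) -> (LScat R (realization R X) <= 1)%E.
Proof.
move=> Xq Xc; pose F := faces X; have dF : down_closed F := @down_closed_faces _ X.
have ce : cone_ext (R := R) (skeleton q F) (skeleton q.+1 F).
  exact: conic_cone_ext (faces0 X) Xc.
pose x (z : realization R X) : 'rV[R]_n := \val z.
pose h (z : realization R X) : R := order_stat q.+1 (x z).
have xP (z : realization R X) : simplex_points X (x z) by exact: set_valP.
have x0 z i : 0 <= x z ord0 i by have [] := xP z.
have x1 z i : x z ord0 i <= 1.
  by have [_ <- _] := xP z; rewrite (bigD1 i) //= lerDl sumr_ge0.
have h0 z : 0 <= h z by exact: order_stat_ge0.
have xc (A : set (realization R X)) : {within A, continuous x}.
  by apply: within_global; exact: initial_continuous.
have hc (A : set (realization R X)) : {within A, continuous h}.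
  by apply: within_order_stat; exact: xc.
have opos (f : realization R X -> R) : {within setT, continuous f} ->
    open [set z | 0 < f z].
  move=> /(continuous_subspace_setT f).2 fc.
  by apply: (@open_comp _ _ f [set y | 0 < y]) => [z _|];
    [exact: fc | exact: open_gt].
pose U0 := [set z : realization R X | exists i, h z < x z ord0 i].
pose U1 := [set z : realization R X | 0 < h z].
pose f0 (z : realization R X) : 'rV[R]_n := \row_i Num.max (x z ord0 i - h z) 0.
pose f1 (z : realization R X) : 'rV[R]_n := \row_i Num.max
  (Num.min (x z ord0 i) (h z) - \big[Num.max/0]_(j < n | (j < i)%N) x z ord0 j) 0.
have f0c : {within U0, continuous f0}.
  apply: within_row => i.
  apply: (@within_eq _ _ _ (fun z => Num.max (x z ord0 i - h z) 0)) => [z _|].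
    by rewrite mxE.
  apply: within_max; last exact: within_cst.
  by apply: within_sub => //; apply: within_coord; exact: xc.
have f1c : {within U1, continuous f1}.
  apply: within_row => i.
  apply: (@within_eq _ _ _ (fun z => Num.max (Num.min (x z ord0 i) (h z) -
      \big[Num.max/0]_(j < n | (j < i)%N) x z ord0 j) 0)) => [z _|].
    by rewrite mxE.
  apply: within_max; last exact: within_cst.
  apply: within_sub.
    by apply: within_min => //; apply: within_coord; exact: xc.
  apply: within_big => [a b ac bc||j]; [exact: within_max|exact: within_cst|].
  by apply: within_coord; exact: xc.
have max_neq0 (a : R) : (Num.max a 0 != 0) = (0 < a).
  by rewrite maxEle; case: leP => [a0|/gt_eqF->//]; rewrite eqxx.
have nh0 : null_homotopic R (set_val : U0 -> realization R X).
  apply: null_homotopic_skeleton ce f0c _ => z [i hi]; split.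
  - by move=> j; rewrite mxE le_max lexx orbT.
  - apply/eqP => /rowP/(_ i)/eqP; rewrite !mxE; apply/negP.
    by rewrite max_neq0 subr_gt0.
  - apply/fintype.subsetP => j; rewrite !finset.inE mxE max_neq0 subr_gt0 => hj.
    by rewrite gt_eqF // (le_lt_trans (h0 z)).
  - apply: leq_trans (card_gt_order_stat q (x1 z)).
    apply/subset_leq_card/fintype.subsetP => j; rewrite !finset.inE mxE.
    by rewrite max_neq0 subr_gt0.
have nh1 : null_homotopic R (set_val : U1 -> realization R X).
  apply: null_homotopic_skeleton ce f1c _ => z hz.
  set B := [set i | (h z <= x z ord0 i)%R]%SET.
  have Bq : (q < #|B|)%N by exact: order_stat_attained.
  have sB : B \subset supp (x z).
    apply/fintype.subsetP => j; rewrite !finset.inE => hj.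
    by rewrite gt_eqF // (lt_le_trans hz).
  have big0 i : 0 <= \big[Num.max/0]_(j < n | (j < i)%N) x z ord0 j.
    exact: bigmax_ge_id.
  have f1P i : (i \in supp (f1 z)) = (\big[Num.max/0]_(j < n | (j < i)%N) x z ord0 j <
      Num.min (x z ord0 i) (h z)).
    by rewrite finset.inE mxE max_neq0 subr_gt0.
  have sx : supp (f1 z) \subset supp (x z).
    apply/fintype.subsetP => j; rewrite f1P lt_min => /andP[+ _].
    by rewrite finset.inE => /(le_lt_trans (big0 _))/gt_eqF->.
  split => //.
  - by move=> j; rewrite mxE le_max lexx orbT.
  (* The first index whose coordinate reaches [h] is a record, so [f1 z] is not zero. *)
  - have [i0 i0B] : exists i, i \in B.
      by apply/set0Pn; rewrite -card_gt0 (leq_trans _ Bq).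
    have [i iB imin] := arg_minnP (fun i : 'I_n => i : nat) i0B.
    suff : i \in supp (f1 z).
      by apply: contraTneq => ->; rewrite supp0 finset.inE.
    have {}iB : i \in B by [].
    rewrite f1P min_r; last by rewrite finset.inE in iB.
    apply: bigmax_lt => // j ji; rewrite ltNge; apply/negP => hj.
    have /imin : j \in B by rewrite finset.inE.
    by rewrite leqNgt ji.
  (* After a coordinate has reached [h], none of the later values, truncated at [h], can exceed
     it. *)
  - have one : (#|supp (f1 z) :&: B|%SET <= 1)%N.
      apply/card_le1_eqP => i j.
      wlog ij : i j / (i < j)%N => [W iS jS|].
        by case: (ltngtP i j) => ij; [exact: W|exact/esym/W|exact/val_inj].
      rewrite !finset.in_setI => /andP[_ iB] /andP[+ _].
      have hi : h z <= x z ord0 i by rewrite finset.inE in iB.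
      rewrite f1P lt_min => /andP[_].
      have := @le_bigmax_cond _ _ _ 0 i (fun k : 'I_n => (k < j)%N)
        (fun k => x z ord0 k) ij.
      by move=> /(le_trans hi)/le_lt_trans H/H; rewrite ltxx.
    have xq : (#|supp (x z)| <= q + q)%N by apply: Xq; have [] := xP z.
    have := subset_leq_card (finset.setSD B sx).
    have := finset.cardsID B (supp (f1 z)).
    have := finset.cardsID B (supp (x z)).
    rewrite (finset.setIidPr sB); move: one xq Bq.
    set a := #|_ :&: _|%SET; set b := #|supp (x z)|; set c := #|B|.
    set d := #|supp (f1 z)|; set e := #|_ :\: _|%SET; set e' := #|_ :\: _|%SET.
    by lia.
apply: ereal_inf_lbound; exists 1%N => //.
exists (fun i : 'I_2 => if i == ord0 then U0 else U1); split.
- move=> i; case: ifP => _; last exact: opos.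
  have -> : U0 = \bigcup_(i in [set: 'I_n]) [set z | 0 < x z ord0 i - h z].
    apply/seteqP; split => [z [j hj]|z [j _]]; last first.
      by rewrite /= subr_gt0 => hj; exists j.
    by exists j => //=; rewrite subr_gt0.
  apply: bigcup_open => j _; apply: opos.
  by apply: within_sub => //; apply: within_coord; exact: xc.
(* Where [h] vanishes, some coordinate is positive and so exceeds [h]. *)
- apply/seteqP; split => // z _.
  have [hz|hz] := ltP 0 (h z); first by exists (lift ord0 ord0).
  exists ord0 => //=; have [x00 xs _] := xP z.
  have [[i xi]|H] := pselect (exists i, 0 < x z ord0 i).
    by exists i; exact: le_lt_trans xi.
  move: xs; rewrite big1 => [/esym/eqP|i _]; first by rewrite oner_eq0.
  apply/eqP; rewrite eq_le x0 andbT leNgt; apply/negP => xi.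
  by apply: H; exists i.
- by move=> i; case: (i == ord0).
Qed.

End CategoricalCover.

(** * Probability estimates *)

Section Probability.
Context {R : realType} {n : nat}.
Variables (p : {set 'I_n} -> R) (mu : probability (subcomplex n) R).
Hypothesis hmu : lower_model p mu.
Implicit Types (A L : {set {set 'I_n}}) (E : set (subcomplex n)).

Definition pr E : R := fine (mu E).

Lemma prE E : mu E = (pr E)%:E.
Proof. by rewrite /pr fineK // fin_num_measure. Qed.

Lemma pr_le E1 E2 : E1 `<=` E2 -> pr E1 <= pr E2.
Proof.
by move=> E12; rewrite -lee_fin -!prE; apply: le_measure => //; rewrite inE.
Qed.

Lemma prD E1 E2 : E2 `<=` E1 -> pr (E1 `\` E2) = pr E1 - pr E2.
Proof.
move=> E21; apply/EFin_inj; rewrite EFinB -!prE measureD //; last first.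
  by rewrite -ge0_fin_numE ?fin_num_measure.
by rewrite (setIidr E21).
Qed.

Lemma prC E : pr (~` E) = 1 - pr E.
Proof. by apply/EFin_inj; rewrite EFinB -!prE probability_setC. Qed.

Lemma pr_union (I : eqType) (r : seq I) (F : I -> set (subcomplex n)) (c : R) E :
  E `<=` [set X | exists2 i, i \in r & F i X] ->
  (forall i, i \in r -> pr (F i) <= c) -> pr E <= (size r)%:R * c.
Proof.
elim: r E => [|i r IHr] E Er Fc.
  rewrite mul0r (_ : E = set0); first by rewrite /pr measure0.
  by apply/seteqP; split => // X /Er[].
have -> : pr E = pr (E `&` F i) + pr (E `\` (E `&` F i)).
  by rewrite prD; [rewrite addrC subrK | exact: subIsetl].
rewrite /= mulrS mulrDl mul1r; apply: lerD.
  by apply: le_trans (Fc i (mem_head _ _)); apply: pr_le; exact: subIsetr.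
apply: IHr => [X [EX nX]|j jr]; last by apply: Fc; rewrite inE jr orbT.
have [j] := Er _ EX; rewrite inE => /orP[/eqP-> FX|jr FX]; last by exists j.
by case: nX.
Qed.

Definition weight A : R := \prod_(s in A | s != finset.set0) p s.

Lemma pr_contains A : down_closed A ->
  pr [set X | A \subset faces X] = weight A.
Proof.
move=> dA; pose S := [set s in A | s != finset.set0]%SET.
have SP : is_subcomplex S.
  apply/forall_inP => s; rewrite finset.inE => /andP[sA s0]; rewrite s0 /=.
  apply/forallP => t; apply/implyP => /andP[ts t0].
  by rewrite finset.inE t0 (dA _ _ ts sA).
apply/EFin_inj; rewrite -prE.
have -> : [set X : subcomplex n | A \subset faces X] =
    [set X : subcomplex n | S \subset simplices X].
  apply/seteqP; split => X /= /fintype.subsetP SX;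
    apply/fintype.subsetP => s sA; last first.
    rewrite !finset.inE; have [//|s0] := eqVneq s finset.set0.
    by apply: SX; rewrite finset.inE sA.
  move: sA; rewrite finset.inE => /andP[sA s0].
  by have := SX _ sA; rewrite !finset.inE (negPf s0).
rewrite (hmu (Subcomplex SP)) /=; congr _%:E.
by apply: eq_bigl => s; rewrite finset.inE.
Qed.

(** The factors gained by coning off [A]; an empty face in [A] contributes the vertex [w] itself. *)
Definition cone_weight A (w : 'I_n) : R := \prod_(t in A) p (w |: t)%SET.

(** The faces through [w] are new, as no member of [L] contains [w], so their factors come on top of
    those of [L]. *)
Lemma weight_cone L A w : A \subset L -> (forall t, t \in L -> w \notin t) ->
  weight (L :|: vcone w A)%SET = weight L * cone_weight A w.
Proof.
move=> AL wL; pose B := [set w |: t | t in A]%SET.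
have wB s : s \in B -> w \in s by case/imsetP => t _ ->; rewrite !finset.inE eqxx.
have -> : (L :|: vcone w A = L :|: B)%SET.
  by rewrite /vcone finset.setUA (finset.setUidPl AL).
rewrite /weight (bigID (mem L)) /=; congr (_ * _).
  by apply: eq_bigl => s; rewrite !finset.inE; case: (s \in L); rewrite ?andbF ?andbT.
rewrite /cone_weight (eq_bigl (fun s => s \in B)) /=.
  rewrite big_imset //= => t t' tA t'A E.
  have wt := wL _ (fintype.subsetP AL _ tA); have wt' := wL _ (fintype.subsetP AL _ t'A).
  by rewrite -(setU1K wt) E setU1K.
move=> s; rewrite !finset.inE; have [sB|] := boolP (s \in B); last first.
  by move=> _; case: (s \in L); rewrite ?andbF.
have ws := wB _ sB; rewrite orbT /=; apply/andP; split.
  by apply/set0Pn; exists w.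
by apply/negP => /wL; rewrite ws.
Qed.

(** Independence of distinct apexes, derived from containment probabilities alone: the event for
    [w :: W] is the event for [W] minus the same event with [L] enlarged by [vcone w A]. The family
    [L] is allowed to exceed [A] for the sake of this induction. *)
Lemma pr_avoid L A (W : seq 'I_n) : uniq W -> down_closed L -> down_closed A ->
  A \subset L -> (forall w t, w \in W -> t \in L -> w \notin t) ->
  pr [set X | L \subset faces X /\
              forall w, w \in W -> ~~ (vcone w A \subset faces X)] =
    weight L * \prod_(w <- W) (1 - cone_weight A w).
Proof.
move=> + + dA; elim: W L => [|w W IHW] L /=.
  move=> _ dL _ _; rewrite big_nil mulr1 -pr_contains //; congr pr.
  by apply/seteqP; split => // X [].
move=> /andP[wW uW] dL AL wL.
pose L' := (L :|: vcone w A)%SET.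
have dL' : down_closed L'.
  move=> s t ts; rewrite [s \in _]finset.in_setU [t \in _]finset.in_setU.
  case/orP => [sL|sA]; first by rewrite (dL _ _ ts sL).
  by rewrite (down_closed_vcone dA ts sA) orbT.
pose av (K : {set {set 'I_n}}) := [set X : subcomplex n | K \subset faces X /\
  forall w, w \in W -> ~~ (vcone w A \subset faces X)].
have -> : [set X : subcomplex n | L \subset faces X /\
    forall w', w' \in w :: W -> ~~ (vcone w' A \subset faces X)] = av L `\` av L'.
  apply/seteqP; split => X /=.
    move=> [LX wX]; split.
      by split => // w' w'W; apply: wX; rewrite inE w'W orbT.
    move=> [+ _]; rewrite finset.subUset => /andP[_].
    by apply/negP/wX/mem_head.
  move=> [[LX wX] nX]; split => // w'; rewrite inE => /orP[/eqP->|]; last exact: wX.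
  by apply/negP => wA; apply: nX; split => //; rewrite finset.subUset LX.
rewrite prD; last by move=> X [+ wX]; rewrite finset.subUset => /andP[].
have wL0 t : t \in L -> w \notin t by apply: wL; exact: mem_head.
rewrite !IHW //.
- by rewrite weight_cone // big_cons; ring.
- by apply: fintype.subset_trans AL _; exact: finset.subsetUl.
- move=> w' t w'W; rewrite !finset.inE.
  have w'L s : s \in L -> w' \notin s by apply: wL; rewrite inE w'W orbT.
  case/or3P => [|/(fintype.subsetP AL)|/imsetP[s /(fintype.subsetP AL) sL ->]];
    try exact: w'L.
  rewrite !finset.inE negb_or w'L // andbT.
  by apply: contraNneq wW => <-.
- by move=> w' t w'W; apply: wL; rewrite inE w'W orbT.
Qed.

End Probability.

(** * Estimates in the medial regime *)

Section Bounds.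
Context {R : realType} {n : nat}.
Variables (p : {set 'I_n} -> R) (mu : probability (subcomplex n) R).
Hypothesis hmu : lower_model p mu.
Variables (a b : R).
Hypotheses (a0 : 0 < a) (ab : a <= b) (b1 : b < 1).
Hypothesis pab : forall s, s != finset.set0 -> a <= p s <= b.
Implicit Types (A L : {set {set 'I_n}}) (E : set (subcomplex n)).

Lemma pr_setU E1 E2 : pr mu (E1 `|` E2) <= pr mu E1 + pr mu E2.
Proof.
have : pr mu ((E1 `|` E2) `\` E1) <= pr mu E2.
  by apply: pr_le => X [[]].
by rewrite prD; [rewrite lerBlDl | exact: subsetUl].
Qed.

Lemma face_prob_bounds s : s != finset.set0 -> 0 <= p s <= 1.
Proof.
by move=> /pab/andP[ap pb]; rewrite (le_trans (ltW a0) ap) (le_trans pb (ltW b1)).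
Qed.

Let b_ge0 : 0 <= b. Proof. exact: le_trans (ltW a0) ab. Qed.

Let pow_le1 k : 0 <= a ^+ k <= 1.
Proof.
rewrite exprn_ge0 ?(ltW a0) // exprn_ile1 ?(ltW a0) //.
exact: le_trans ab (ltW b1).
Qed.

Lemma weight_bounds A : 0 <= weight p A <= 1.
Proof.
apply/andP; split; first by apply: prodr_ge0 => s /andP[_ /face_prob_bounds/andP[]].
by apply: prodr_ile1 => s /andP[_ /face_prob_bounds].
Qed.

Lemma cone_weight_bounds A w k : (#|A| <= k)%N -> a ^+ k <= cone_weight p A w <= 1.
Proof.
move=> Ak.
have w0 (t : {set 'I_n}) : (w |: t)%SET != finset.set0.
  by apply/set0Pn; exists w; rewrite !finset.inE eqxx.
apply/andP; split; last by apply: prodr_ile1 => s _; exact: face_prob_bounds.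
apply: (@le_trans _ _ (a ^+ #|A|)).
  by apply: ler_wiXn2l => //; [exact: ltW | exact: le_trans ab (ltW b1)].
rewrite -prodr_const; apply: ler_prod => t _.
by have /andP[? _] := pab (w0 t); rewrite (ltW a0).
Qed.

(** A simplex brings along its [2 ^ m.+1 - 1] non-empty faces, each costing a factor of at most
    [b]. *)
Lemma pr_simplex (s : {set 'I_n}) m : #|s| = m.+1 ->
  pr mu [set X : subcomplex n | s \in simplices X] <= b ^+ (2 ^ m.+1).-1.
Proof.
move=> sm.
have dP : down_closed (powerset s).
  by move=> t u ut; rewrite !powersetE; exact: fintype.subset_trans.
have s0 : s != finset.set0 by rewrite -card_gt0 sm.
have : pr mu [set X : subcomplex n | powerset s \subset faces X] <= b ^+ (2 ^ m.+1).-1.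
  rewrite (pr_contains hmu dP) /weight.
  apply: (@le_trans _ _ (\prod_(t in powerset s | t != finset.set0) b)).
    apply: ler_prod => t /andP[_ t0].
    by have /andP[-> _] := face_prob_bounds t0; have /andP[] := pab t0.
  rewrite prodr_const -sm -card_powerset (cardsD1 finset.set0 (powerset s)).
  rewrite powersetE finset.sub0set add1n /= le_eqVlt; apply/orP; left.
  apply/eqP; congr (_ ^+ _); apply: eq_card => t; rewrite !finset.inE.
  by rewrite unfold_in powersetE andbC.
apply: le_trans; apply: pr_le => X /= sX.
apply/fintype.subsetP => t; rewrite powersetE => ts.
by apply: (down_closed_faces ts); rewrite finset.inE sX orbT.
Qed.

(** Given [A], each of the at least [n - k] vertices outside [cover A] independently fails to cone
    it off with probability at most [1 - a ^+ k]. *)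
Lemma pr_avoid_le A k : A \in small_families 'I_n k -> down_closed A ->
  pr mu [set X : subcomplex n | A \subset faces X /\
    forall w, w \in enum (~: finset.cover A)%SET -> ~~ (vcone w A \subset faces X)]
    <= (1 - a ^+ k) ^+ (n - k).
Proof.
rewrite finset.inE => /and3P[A0 Ak Ck] dA.
rewrite (pr_avoid hmu) //; last 2 first.
- exact: enum_uniq.
- move=> w t; rewrite mem_enum finset.inE => wA tA.
  by apply: contra wA => wt; apply/bigcupP; exists t.
have /andP[w0 w1] := weight_bounds A.
have /andP[ak0 ak1] := pow_le1 k.
apply: (@le_trans _ _
    (\prod_(w <- enum (~: finset.cover A)%SET) (1 - cone_weight p A w))).
  rewrite ler_piMl // prodr_ge0 // => w _.
  by have /andP[_] := cone_weight_bounds w Ak; lra.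
apply: (@le_trans _ _ (\prod_(w <- enum (~: finset.cover A)%SET) (1 - a ^+ k))).
  apply: ler_prod => w _; have /andP[] := cone_weight_bounds w Ak; lra.
rewrite big_enum prodr_const.
apply: ler_wiXn2l; [lra|lra|].
by rewrite cardsCs finset.setCK card_ord leq_sub2l.
Qed.

(** Two union bounds: over the vertex sets of simplexes that are too large, and over the small
    families left without an apex. *)
Lemma pr_LScat_le1 q : (0 < n)%N ->
  1 - pr mu [set X : subcomplex n | (LScat R (realization R X) <= 1)%E] <=
    (n ^ (q + q).+1)%:R * b ^+ (2 ^ (q + q).+1).-1 +
    (n ^ (3 ^ q) * 2 ^ (3 ^ q * 3 ^ q))%:R * (1 - a ^+ (3 ^ q)) ^+ (n - 3 ^ q).
Proof.
move=> n0; rewrite -prC; set k := (3 ^ q)%N; set good := [set X | _].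
pose D := [set s : {set 'I_n} | #|s| == (q + q).+1]%SET.
pose big := [set X : subcomplex n | exists2 s : {set 'I_n},
  s \in enum D & s \in simplices X].
pose Fam := [set A in small_families 'I_n k | `[< down_closed A >]]%SET.
pose avoid A := [set X : subcomplex n | A \subset faces X /\
    forall w, w \in enum (~: finset.cover A)%SET -> ~~ (vcone w A \subset faces X)].
pose bare := [set X : subcomplex n | exists2 A, A \in enum Fam & avoid A X].
have badP : ~` good `<=` big `|` bare.
  move=> X nX; apply: contrapT => H; apply: nX; apply: (@LScat_le1 _ _ X q).
    (* A simplex with more than [q + q] vertices has a face with exactly [(q + q).+1] of them. *)
    move=> s sX; rewrite leqNgt; apply/negP => /card_geqP[l [lu lk ls]].
    apply: H; left; exists [set x in l]%SET.
      by rewrite mem_enum finset.inE cardsE (card_uniqP lu) lk.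
    have /(@down_closed_faces _ X _ _) : [set x in l]%SET \subset s.
      by apply/fintype.subsetP => x; rewrite finset.inE => /ls.
    move=> /(_ _)/[!finset.inE]; rewrite sX orbT => /(_ isT)/orP[/eqP l0|//].
    by have := card_uniqP lu; rewrite -cardsE l0 cards0 lk.
  apply: conicI => A Ak dA AX; apply: contrapT => nw; apply: H; right.
  exists A; first by rewrite mem_enum finset.inE Ak; apply/asboolP.
  split => // w; rewrite mem_enum finset.inE => wA.
  by apply/negP => wX; apply: nw; exists w.
apply: le_trans (pr_le mu badP) _; apply: le_trans (pr_setU _ _) _.
apply: lerD.
  apply: (@le_trans _ _ ((size (enum D))%:R * b ^+ (2 ^ (q + q).+1).-1)).
    apply: (pr_union (F := fun s => [set X : subcomplex n | s \in simplices X])) => // s.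
    by rewrite mem_enum finset.inE => /eqP; exact: pr_simplex.
  apply: ler_wpM2r; first by rewrite exprn_ge0.
  by rewrite ler_nat -cardE -[n in (n ^ _)%N]card_ord card_draws_le.
apply: (@le_trans _ _ ((size (enum Fam))%:R * (1 - a ^+ k) ^+ (n - k))).
  apply: (pr_union (F := avoid)) => // A.
  rewrite mem_enum finset.inE => /andP[Ak /asboolP dA]; exact: pr_avoid_le.
apply: ler_wpM2r.
  by rewrite exprn_ge0 // subr_ge0; have /andP[] := pow_le1 k.
rewrite ler_nat -cardE; apply: leq_trans (_ : #|small_families 'I_n k| <= _)%N.
  by apply/subset_leq_card/fintype.subsetP => A; rewrite finset.inE => /andP[].
by rewrite -[X in (X ^ _)%N]card_ord; apply: card_small_families; rewrite card_ord.
Qed.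

End Bounds.

(** * Asymptotics as the number of vertices grows *)

Section Limit.
Context {R : realType}.

Lemma exists_exp_le (z e : R) : 0 <= z < 1 -> 0 < e -> exists m, z ^+ m <= e.
Proof.
move=> /andP[z0 z1] e0; have zc : `|z| < 1 by rewrite ger0_norm.
have /cvgrPdist_le/(_ _ e0)[m _ /(_ m (leqnn m))] := cvg_expr zc.
by rewrite /= sub0r normrN ger0_norm ?exprn_ge0 //; exists m.
Qed.

(** By Bernoulli's inequality [(1 + x) ^+ Q] is at least [2], and its product with [(1 - x) ^+ Q] is
    at most [1]. *)
Lemma expr_1subV_le (x : R) Q : 0 <= x <= 1 -> 1 <= x * Q%:R ->
  (1 - x) ^+ Q <= 2^-1.
Proof.
move=> /andP[x0 x1] xQ.
have bern : 1 + x * Q%:R <= (1 + x) ^+ Q.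
  elim: Q {xQ} => [|Q IHQ]; first by rewrite mulr0 addr0 expr0.
  rewrite exprS; apply: (@le_trans _ _ ((1 + x) * (1 + x * Q%:R))).
    rewrite -natr1; have : 0 <= x * x * Q%:R by rewrite !mulr_ge0.
    by lra.
  by apply: ler_wpM2l => //; lra.
have prod : (1 - x) ^+ Q * (1 + x) ^+ Q <= 1.
  rewrite -exprMn exprn_ile1 //; first by apply: mulr_ge0; lra.
  by have : 0 <= x * x by [exact: mulr_ge0]; lra.
have y0 : 0 <= (1 - x) ^+ Q by rewrite exprn_ge0 // subr_ge0.
have h2 : 2 <= (1 + x) ^+ Q by apply: le_trans bern; lra.
have : (1 - x) ^+ Q * 2 <= 1 by apply: le_trans prod; exact: ler_wpM2l.
by lra.
Qed.

(** Everything is compared with powers of one half: a union of at most [2 ^ e] events needs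
    individual probabilities of at most [2^-1 ^+ (e + K)]. *)
Lemma asymptotic_bounds (a b : R) (n K q c : nat) :
  (2 ^ K <= n)%N -> (n <= 2 ^ K.+1)%N ->
  0 <= b -> b <= 1 -> a <= 1 -> 2^-1 ^+ c <= a -> b ^+ c <= 2^-1 ->
  (c * (K.+1 * (q + q).+1 + K) <= (2 ^ (q + q).+1).-1)%N -> (3 ^ q <= K)%N ->
  (2 ^ (c * 3 ^ q) * (2 * K ^ 2 + 2 * K) + K <= 2 ^ K)%N ->
  (n ^ (q + q).+1)%:R * b ^+ (2 ^ (q + q).+1).-1 <= 2^-1 ^+ K /\
  (n ^ (3 ^ q) * 2 ^ (3 ^ q * 3 ^ q))%:R * (1 - a ^+ (3 ^ q)) ^+ (n - 3 ^ q)
    <= 2^-1 ^+ K.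
Proof.
move=> Kn nK b0 b1 a1 ca cb e1 e2 e3.
have h0 : (0 : R) <= 2^-1 by lra.
have h1 : (2^-1 : R) <= 1 by lra.
have twoV m e : (m <= 2 ^ e)%N -> forall y : R, y <= 2^-1 ^+ (e + K) ->
    m%:R * y <= 2^-1 ^+ K.
  move=> me y yK; apply: (@le_trans _ _ (m%:R * 2^-1 ^+ (e + K))).
    exact: ler_wpM2l.
  apply: (@le_trans _ _ ((2 ^ e)%:R * 2^-1 ^+ (e + K))).
    by rewrite ler_wpM2r ?exprn_ge0 // ler_nat.
  by rewrite exprD mulrA natrX -exprMn mulfV // expr1n mul1r.
have b2 e m : (c * e <= m)%N -> b ^+ m <= 2^-1 ^+ e.
  move=> cem; apply: (@le_trans _ _ (b ^+ (c * e))); first exact: ler_wiXn2l.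
  by rewrite exprM lerXn2r // nnegrE exprn_ge0.
split.
  apply: (twoV _ (K.+1 * (q + q).+1)%N); last exact: b2.
  by rewrite expnM leq_exp2r.
set k := (3 ^ q)%N in e2 e3 *; set Q := (2 ^ (c * k))%N in e3.
set j := (2 * K ^ 2 + 2 * K)%N in e3.
apply: (twoV _ (K.+1 * k + k * k)%N).
  by rewrite expnD leq_mul // expnM leq_exp2r // expn_gt0.
have a0 : 0 <= a by apply: le_trans ca; exact: exprn_ge0.
have xle : 0 <= a ^+ k <= 1 by rewrite exprn_ge0 // exprn_ile1.
(* Hence each block of [Q] apexes halves the probability of failure, and there is room for [j]
   disjoint blocks. *)
have xQ : 1 <= a ^+ k * Q%:R.
  rewrite /Q natrX exprM -exprMn; apply: exprn_ege1.
  apply: (@le_trans _ _ (2^-1 ^+ c * 2 ^+ c)).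
    by rewrite -exprMn mulVf // expr1n.
  by rewrite ler_wpM2r // exprn_ge0.
have z01 : 0 <= 1 - a ^+ k <= 1 by have /andP[? ?] := xle; apply/andP; split; lra.
have /andP[z0 z1] := z01.
apply: (@le_trans _ _ ((1 - a ^+ k) ^+ (Q * j))).
  apply: ler_wiXn2l => //.
  have kQj : (k + Q * j <= n)%N.
    by apply: leq_trans Kn; apply: leq_trans e3; rewrite addnC leq_add2l.
  by rewrite leq_subRL // (leq_trans (leq_addr _ _) kQj).
rewrite exprM; apply: (@le_trans _ _ (2^-1 ^+ j)).
  rewrite lerXn2r // ?nnegrE ?exprn_ge0 //; exact: expr_1subV_le.
by apply: ler_wiXn2l => //; exact: exponent_sum_le.
Qed.

End Limit.

Theorem theorem15 (R : realType) (p : forall n : nat, {set 'I_n} -> R)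
    (mu : forall n : nat, probability (subcomplex n) R)
    (hmodel : forall n : nat, lower_model (p n) (mu n))
    (hmedial : medial_regime p) :
  (mu n [set X : subcomplex n | (LScat R (realization R X) <= 1)%E])
    @[n --> \oo] --> 1%E.
Proof.
have [a [b [a0 ab b1 pab]]] := hmedial.
pose f n := pr (mu n) [set X : subcomplex n | (LScat R (realization R X) <= 1)%E].
suff fl : f n @[n --> \oo] --> (1 : R).
  rewrite (_ : (fun n => _) = EFin \o f); last by apply/funext => n; rewrite /= prE.
  by apply: cvg_EFin => //; exact: nearW.
have b0 : 0 <= b by exact: le_trans (ltW a0) ab.
have a1 : a <= 1 by exact: le_trans ab (ltW b1).
have half0 : (0 : R) < 2^-1 by rewrite invr_gt0.
have half1 : (2^-1 : R) < 1 by rewrite invf_lt1 // ltr1n.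
have [|//|c1 hc1] := @exists_exp_le R b 2^-1; first by rewrite b0.
have [|//|c2 hc2] := @exists_exp_le R 2^-1 a; first by rewrite (ltW half0).
(* One positive exponent that serves both [a] and [b]. *)
pose c := (c1 + c2).+1.
have bc : b ^+ c <= 2^-1.
  by apply: le_trans hc1; apply: ler_wiXn2l; rewrite ?(ltW b1) // /c; lia.
have ac : 2^-1 ^+ c <= a.
  by apply: le_trans hc2; apply: ler_wiXn2l; rewrite ?(ltW half0) ?(ltW half1) // /c; lia.
have [//|K0 HK] := @exponent_choice c.
(* The factor [4] arises from two error terms [2^-1 ^+ K], each at most [2 / (n + 1)] because
   [n + 1 <= 2 ^ K.+1]. *)
have lim1 : (1 - 4 * harmonic n : R) @[n --> \oo] --> (1 : R).
  rewrite -[X in _ --> X]subr0 -[X in _ --> _ - X](mulr0 4).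
  by apply: cvgB; [exact: cvg_cst | apply: cvgMr; exact: cvg_harmonic].
apply: (@squeeze_cvgr _ _ _ R _ (fun=> 1) _ _ _ lim1); last exact: cvg_cst.
exists (2 ^ K0)%N => // n /= Kn; apply/andP; split; last first.
  by rewrite -lee_fin -prE probability_le1.
have n0 : (0 < n)%N by apply: leq_trans Kn; rewrite expn_gt0.
pose K := trunc_log 2 n.
have /andP[n1 n2] := trunc_log_bounds (isT : (1 < 2)%N) n0.
have [q [e1 e2 e3]] := HK K (trunc_log_max (isT : (1 < 2)%N) Kn).
have [T1 T2] := asymptotic_bounds n1 (ltnW n2) b0 (ltW b1) a1 ac bc e1 e2 e3.
have pK : 1 - f n <= 2^-1 ^+ K + 2^-1 ^+ K.
  exact: le_trans (pr_LScat_le1 (hmodel n) a0 ab b1 (pab n) q n0) (lerD T1 T2).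
have hK : 2^-1 ^+ K <= 2 * n.+1%:R^-1 :> R.
  rewrite -ler_pdivrMr ?invr_gt0 ?ltr0n // invrK.
  apply: (@le_trans _ _ (2^-1 ^+ K * (2 ^ K.+1)%:R)).
    by rewrite ler_wpM2l ?exprn_ge0 ?(ltW half0) // ler_nat.
  by rewrite expnS natrM mulrCA natrX -exprMn mulVf // expr1n mulr1.
by move: pK hK; move: (f n) (n.+1%:R^-1) (2^-1 ^+ K) => u v w; lra.
Qed.
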